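(* In the flat mid-surface setting of the context, let $\kappa_1(x_1),\kappa_2(x_1)$ be the eigenvalues of $\mathrm{II}^0(x_1)$, ordered so that $|\kappa_1|\le|\kappa_2|$, and let $J:L^2((0,L);\mathbb R^{2\times2}_{\rm sym})\to\mathbb R$, $$J(M)=\frac1{12}\cdot\frac1L\int_0^L\Big(\tilde{\mathcal Q}_2(x_1,M-\mathrm{II}^0(x_1))+\alpha^+_{\mathcal Q}(x_1)(\det M)^++\alpha^-_{\mathcal Q}(x_1)(\det M)^-\Big)dx_1 .$$ Then there are constants $C>c>0$ such that $$c\int_0^L\kappa_1^2\,dx_1\le\min J\le C\int_0^L\kappa_1^2\,dx_1 ;$$ in particular $\min J=0$ if and only if $\det\mathrm{II}^0\equiv0$. Furthermore, there is a constant $c>0$ such that if $\overline{\mathrm{II}}_*$ is a minimizer of $J$, then $$\big|\overline{\mathrm{II}}_*(x_1)-\mathrm{II}^0(x_1)\big|\ge c\,|\kappa_1(x_1)|\qquad\text{for a.e. }x_1\in(0,L).$$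
   Context: **Flat mid-surface data.** $L>0$; $\kappa:[0,L]\to\mathbb R$ is smooth; $\mathrm{II}^0:[0,L]\to\mathbb R^{2\times2}_{\rm sym}$ is smooth (the restriction to the midline of the reference second fundamental form; the reference metric of the mid-surface is the flat metric $\mathrm{diag}((1-\kappa(z_1)z_2)^2,1)$). **Frame.** Let $(e_1,e_2,e_3)$ solve $e_1'=\kappa e_2+\mathrm{II}^0_{11}e_3$, $e_2'=-\kappa e_1+\mathrm{II}^0_{12}e_3$, $e_3'=-\mathrm{II}^0_{11}e_1-\mathrm{II}^0_{12}e_2$ on $[0,L]$ with $(e_1|e_2|e_3)(0)\in \mathrm{SO}(3)$; $Q_0=(e_1|e_2|e_3):[0,L]\to \mathrm{SO}(3)$. **Energy density.** $\mathcal W:\mathbb R^{3\times3}\to[0,\infty]$ is continuous, $\mathcal W(RA)=\mathcal W(A)$ for $R\in \mathrm{SO}(3)$, $\mathcal W(A)=0$ iff $A\in \mathrm{SO}(3)$, $\mathcal W(A)\ge c\,\mathrm{dist}^2(A,\mathrm{SO}(3))$ for some $c>0$, and $\mathcal W$ is $C^2$ near $\mathrm{SO}(3)$. $\mathcal Q_3(B)=\frac12D^2_I\mathcal W(B,B)$; thus $\mathcal Q_3(B)=\mathcal Q_3(\mathrm{sym}\,B)\ge c|\mathrm{sym}\,B|^2$. **Limit densities.** $\tilde{\mathcal Q}_2(x_1,A)=\min\{\mathcal Q_3(Q_0(x_1)BQ_0(x_1)^T):B\in\mathbb R^{3\times3},\ B_{2\times2}=A\}$, where $B_{2\times2}$ is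 the upper-left $2\times2$ block, and $$\alpha^\pm_{\mathcal Q}(x_1)=\sup\{\alpha>0:\ \tilde{\mathcal Q}_2(x_1,M)\pm\alpha\det M\ge0\ \text{for every }M\in\mathbb R^{2\times2}_{\rm sym}\}.$$ $s^+=\max\{s,0\}$, $s^-=\max\{-s,0\}$. The functional $J$ arises as the $\Gamma$-limit, as $w\to 0$, of plate energies of ribbons of width $w$ with flat mid-surface; $\det\mathrm{II}^0\not\equiv0$ means that the ribbon is Gauss-incompatible. *)

(* Defs.v *)
From mathcomp Require Import all_boot all_order all_algebra.
From mathcomp Require Import all_classical all_reals all_analysis.

Set Implicit Arguments.
Unset Strict Implicit.
Unset Printing Implicit Defensive.

Import Order.TTheory GRing.Theory Num.Theory.
Import numFieldNormedType.Exports.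

Local Open Scope classical_set_scope.
Local Open Scope ring_scope.

Section Defs.
Context {R : realType}.

Definition SO3 : set 'M[R]_3 := [set Q | Q^T *m Q = 1%:M /\ \det Q = 1].

Definition frob m n (A : 'M[R]_(m, n)) : R :=
  Num.sqrt (\sum_i \sum_j A i j ^+ 2).

Definition dist_SO3 (A : 'M[R]_3) : R := inf [set frob (A - Q) | Q in SO3].

(* All derivatives exist on ]a, b[ and extend continuously to [a, b]; [g n] is
   the continuous extension of the n-th derivative of f.  The values of f
   outside [a, b] are irrelevant. *)
Definition smooth_on (a b : R) (f : R -> R) : Prop :=
  exists g : nat -> R -> R,
    (forall x, x \in `[a, b] -> g 0%N x = f x) /\
    forall n, {within `[a, b], continuous (g n)} /\
      forall x : R, x \in `]a, b[ -> is_derive x 1 (g n) (g n.+1 x).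

(* Twice continuously (Frechet) differentiable on U; the continuity of the
   second differential is expressed through its components, which is the same
   thing in finite dimension. *)
Definition C2_on (U : set 'M[R]_3) (f : 'M[R]_3 -> R) : Prop :=
  forall A, U A ->
    [/\ differentiable f A,
        forall B, differentiable (fun X => 'D_B f X) A &
        forall B C, {for A, continuous (fun X => 'D_C (fun Y => 'D_B f Y) X)}].

Record energy_density (W : 'M[R]_3 -> \bar R) : Prop := EnergyDensity {
  energy_ge0 : forall A, (0 <= W A)%E ;
  energy_continuous : continuous W ;
  energy_frame_indifferent : forall Q A, SO3 Q -> W (Q *m A) = W A ;
  energy_eq0 : forall A, W A = 0%E <-> SO3 A ;
  energy_coercive : exists2 c : R, 0 < c &
    forall A, ((c * dist_SO3 A ^+ 2)%:E <= W A)%E ;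
  energy_C2 : exists U : set 'M[R]_3,
    [/\ open U, SO3 `<=` U, forall A, U A -> W A \is a fin_num &
        C2_on U (fun A => fine (W A))]
}.

Definition Q3 (W : 'M[R]_3 -> \bar R) (B : 'M[R]_3) : R :=
  2^-1 * 'D_B (fun A => 'D_B (fun X => fine (W X)) A) 1%:M.

(* The equations are required on ]0, L[ and the solution is continuous up to
   the end points; the right-hand side being continuous on [0, L], this is the
   same as having one-sided derivatives at 0 and L. *)
Definition is_frame (L : R) (kappa : R -> R) (II0 : R -> 'M[R]_2)
    (e1 e2 e3 : R -> 'cV[R]_3) : Prop :=
  [/\ {within `[0, L], continuous e1},
      {within `[0, L], continuous e2},
      {within `[0, L], continuous e3} &
      forall x : R, x \in `]0, L[ ->
      [/\ is_derive x 1 e1 (kappa x *: e2 x + II0 x 0 0 *: e3 x),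
          is_derive x 1 e2 (- kappa x *: e1 x + II0 x 0 1 *: e3 x) &
          is_derive x 1 e3 (- II0 x 0 0 *: e1 x - II0 x 0 1 *: e2 x)]].

Definition frame_mx (e1 e2 e3 : R -> 'cV[R]_3) (x : R) : 'M[R]_3 :=
  row_mx (e1 x) (row_mx (e2 x) (e3 x)).

Definition block22 (B : 'M[R]_3) : 'M[R]_2 := @ulsubmx R 2 1 2 1 B.

(* For an energy density W the quadratic form [Q3 W] is nonnegative, so that
   the infimum is a minimum. *)
Definition Q2 (W : 'M[R]_3 -> \bar R) (Q0 : R -> 'M[R]_3) (x : R)
    (A : 'M[R]_2) : R :=
  inf [set Q3 W (Q0 x *m B *m (Q0 x)^T) | B in [set B | block22 B = A]].

(* The sets below are nonempty and bounded above when W is an energy density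
   and Q0 x is a rotation, so that [sup] is the actual least upper bound. *)
Definition alpha_plus (W : 'M[R]_3 -> \bar R) (Q0 : R -> 'M[R]_3) (x : R) : R :=
  sup [set a : R | 0 < a /\
    forall M : 'M[R]_2, M^T = M -> 0 <= Q2 W Q0 x M + a * \det M].

Definition alpha_minus (W : 'M[R]_3 -> \bar R) (Q0 : R -> 'M[R]_3) (x : R) : R :=
  sup [set a : R | 0 < a /\
    forall M : 'M[R]_2, M^T = M -> 0 <= Q2 W Q0 x M - a * \det M].

Definition pos_part (s : R) : R := Num.max s 0.
Definition neg_part (s : R) : R := Num.max (- s) 0.

(* Representatives of the elements of L^2((0,L); R^{2x2}_sym); the values
   outside ]0, L[ are irrelevant. *)
Definition L2sym (L : R) (M : R -> 'M[R]_2) : Prop :=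
  (forall x, x \in `]0, L[ -> (M x)^T = M x) /\
  forall i j, measurable_fun `]0, L[ (fun x => M x i j) /\
    lebesgue_measure.-integrable `]0, L[ (fun x => (M x i j ^+ 2)%:E).

(* The integrand is nonnegative and has quadratic growth, so the integral is
   finite whenever M is square integrable. *)
Definition J (L : R) (W : 'M[R]_3 -> \bar R) (II0 : R -> 'M[R]_2)
    (Q0 : R -> 'M[R]_3) (M : R -> 'M[R]_2) : R :=
  12^-1 * L^-1 * \int[lebesgue_measure]_(x in `]0, L[)
    (Q2 W Q0 x (M x - II0 x)
     + alpha_plus W Q0 x * pos_part (\det (M x))
     + alpha_minus W Q0 x * neg_part (\det (M x))).

Definition is_minimizer (L : R) (F : (R -> 'M[R]_2) -> R)
    (M : R -> 'M[R]_2) : Prop :=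
  L2sym L M /\ forall N, L2sym L N -> F M <= F N.

(* k1 and k2 are the eigenvalues of A, counted with multiplicity. *)
Definition ordered_eigenvalues (A : 'M[R]_2) (k1 k2 : R) : Prop :=
  char_poly A = ('X - k1%:P) * ('X - k2%:P) /\ `|k1| <= `|k2|.

End Defs.

(* Main.v *)
(** The integrand of [J] is handled pointwise.  Write [A] for the second
    fundamental form at [x], with eigenvalues [|k1| <= |k2|], and [D = M - A].
    The form [Q2] is comparable to [|D|^2] on symmetric matrices, hence
    [alpha_plus] and [alpha_minus] lie between two positive constants and the
    density is comparable to [|D|^2 + |det M|].  If [|D|] is small compared with
    [|k1|], then [|det M| >= |k1 k2| / 2 >= k1^2 / 2], so the density is at least
    a multiple of [k1^2]; the singular matrix [M = A - k1] gives the upper bound.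
    If [M] is a minimizer with [|D|] much smaller than [|k1|], shrinking it to
    [(1 - s) M] with [s] a small multiple of [|k1 / k2|] gains a multiple of
    [s |k1 k2|], about [k1^2], in the determinant term, and costs less than that
    in [Q2]: a contradiction.  A minimizer of [J] is obtained by measurable
    selection of pointwise minimizers, and any other minimizer is a pointwise
    minimizer almost everywhere. *)

Require Import Defs.
From mathcomp Require Import all_boot all_order all_algebra.
From mathcomp Require Import all_classical all_reals all_analysis.
From mathcomp Require Import measurable_realfun ring lra.

Set Implicit Arguments.
Unset Strict Implicit.
Unset Printing Implicit Defensive.

Import Order.TTheory GRing.Theory Num.Theory.
Import numFieldNormedType.Exports.

Local Open Scope classical_set_scope.
Local Open Scope ring_scope.

(** The growth of [W] away from SO(3) is given through the distance to SO(3), which is awkward to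
    differentiate. Coercivity of the second differential is therefore read off the Gram defect
    [A^T A - 1]: the distance controls it, and it is polynomial along a line through the identity.
    The infimum [Q2] is handled through near-optimal completions. It inherits from [Q3] two-sided
    bounds by the squared norm and the inequality [Q2 (A + A') <= (1 + e) Q2 A + (1 + e^-1) Q2 A'],
    which drives both the shrinking argument and the Lipschitz estimate behind the selection.
    Orthogonality of the frame makes the constants uniform in [x]: [lo = c0 / 9] bounds [Q2] and the
    two alphas from below, [up = 2 * Cq h] from above. [J] contains no derivative of [M], so
    minimizing it amounts to minimizing the integrand at each point, and the obstacle is
    measurability in [x] of infima over uncountable families. Openness of sublevel sets settles the
    alphas, rational completions settle [Q2], and Lipschitz dependence on [M] settles the
    minimizers. *)

Section Taylor.
Context {R : realType}.

(** For [m] strictly between [d2] and [k], [dphi] stays below [m * t] to the right of 0, and the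
    mean value theorem turns this into [phi t <= m * t ^+ 2], which contradicts the cubic lower
    bound for small [t]. Nonnegativity of [phi] forces [m > 0], so that the intermediate point can
    be replaced by [t]. The factor 2 lost against Taylor's formula only affects the value of the
    coercivity constant. *)
Lemma second_derivative_ge (phi dphi : R -> R) (d2 k C r : R) :
  0 < r -> 0 <= k ->
  (forall t, t \in `]- r, r[ -> is_derive t 1 phi (dphi t)) ->
  is_derive (0 : R) 1 dphi d2 ->
  phi 0 = 0 -> dphi 0 = 0 ->
  (forall t, t \in `]0, r[ -> 0 <= phi t) ->
  (forall t, t \in `]0, r[ -> k * t ^+ 2 - C * t ^+ 3 <= phi t) ->
  k <= d2.
Proof.
move=> r0 k0 Dphi [dd ddE] phi0 dphi0 phi_ge0 phi_ge; rewrite leNgt; apply/negP => d2k.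
set m := (d2 + k) / 2.
have d2m : d2 < m by rewrite /m; lra.
have mk : m < k by rewrite /m; lra.
have [dl dl0 Hdl] : exists2 dl, 0 < dl & forall t, 0 < t < dl -> dphi t < m * t.
  have /cvgrPdist_lt /(_ (m - d2)) := dd.
  rewrite [lim _]ddE subr_gt0 => /(_ d2m)[e /= e0 He]; exists e => // t /andP[t0 te].
  have := He t; rewrite /ball_ /= sub0r normrN gtr0_norm// => /(_ te).
  rewrite gt_eqF// => /(_ isT); rewrite addr0 dphi0 subr0 [_%:A]mulr1.
  rewrite distrC => /(le_lt_trans (ler_norm _)); rewrite ltrD2r.
  by rewrite -[_ *: _]/(_ * _) mulrC ltr_pdivrMr.
(* Inside both intervals of validity, and small enough that [C * t] stays below the gap [k - m]. *)
pose t := Num.min (Num.min (dl / 2) (r / 2)) ((k - m) / (2 * (1 + `|C|))).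
have C1 : 0 < 1 + `|C| by have := normr_ge0 C; lra.
have t0 : 0 < t.
  by rewrite !lt_min !divr_gt0//= ?subr_gt0// mulr_gt0.
have tdl : t < dl by rewrite !gt_min; apply/orP; left; apply/orP; left; lra.
have tr : t < r by rewrite !gt_min; apply/orP; left; apply/orP; right; lra.
have tC : t * (2 * (1 + `|C|)) <= k - m.
  by rewrite -ler_pdivlMr ?mulr_gt0// /t ge_min lexx orbT.
have Dphi' x : 0 <= x <= t -> is_derive x 1 phi (dphi x).
  move=> /andP[x0 xt]; apply: Dphi; rewrite in_itv/=.
  by rewrite (le_lt_trans xt)// andbT (lt_le_trans _ x0)// oppr_lt0.
clearbody t m.
have dphi_oo x : x \in `]0, t[ -> is_derive x 1 phi (dphi x).
  by rewrite in_itv/= => /andP[x0 xt]; apply: Dphi'; rewrite !ltW.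
have cphi : {within `[0, t], continuous phi}.
  by apply: derivable_within_continuous => x; rewrite in_itv/= => /Dphi'[].
have [c] := MVT t0 dphi_oo cphi.
rewrite in_itv/= => /andP[c0 ct]; rewrite phi0 !subr0 => phit.
have tin : t \in `]0, r[ by rewrite in_itv/= t0.
have := phi_ge _ tin; have := phi_ge0 _ tin; rewrite phit.
have := Hdl c; rewrite c0 (lt_trans ct)// => /(_ isT).
set d := dphi c => dm dt0 dtC.
have d_ge0 : 0 <= d by rewrite -(pmulr_lge0 _ t0).

have m0 : 0 < m by rewrite -(pmulr_lgt0 _ c0); apply: le_lt_trans dm.
have dmt : d <= m * t by rewrite (le_trans (ltW dm))// ler_pM2l// ltW.
have h1 : k * t - C * t ^+ 2 <= d.
  by rewrite -(ler_pM2r t0); move: dtC; congr (_ <= _); ring.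
have h2 : k - C * t <= m.
  by rewrite -(ler_pM2r t0); apply: le_trans dmt; move: h1; congr (_ <= _); ring.
have : C * t <= `|C| * t by rewrite ler_pM2r// ler_norm.
lra.
Qed.
End Taylor.

(** * Coercivity of the second differential at the identity *)

Section SquaredNorm.
Context {R : realType}.

Definition sqn m n (A : 'M[R]_(m, n)) : R := \sum_i \sum_j A i j ^+ 2.

Lemma sqn_ge0 m n (A : 'M[R]_(m, n)) : 0 <= sqn A.
Proof. by apply: sumr_ge0 => i _; apply: sumr_ge0 => j _; exact: sqr_ge0. Qed.

Lemma frob_ge0 m n (A : 'M[R]_(m, n)) : 0 <= frob A.
Proof. exact: sqrtr_ge0. Qed.

Lemma sqr_frob m n (A : 'M[R]_(m, n)) : frob A ^+ 2 = sqn A.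
Proof. by rewrite sqr_sqrtr// sqn_ge0. Qed.

Lemma sqr_entry_le_sqn m n (A : 'M[R]_(m, n)) i j : A i j ^+ 2 <= sqn A.
Proof.
rewrite /sqn (bigD1 i)//= (bigD1 j)//= -addrA lerDl addr_ge0//.
  by apply: sumr_ge0 => k _; exact: sqr_ge0.
by apply: sumr_ge0 => k _; apply: sumr_ge0 => l _; exact: sqr_ge0.
Qed.

Lemma entry_le_frob m n (A : 'M[R]_(m, n)) i j : `|A i j| <= frob A.
Proof.
by rewrite -ler_sqr ?nnegrE ?frob_ge0// real_normK ?num_real// sqr_frob sqr_entry_le_sqn.
Qed.

Lemma sqn_trace m n (A : 'M[R]_(m, n)) : sqn A = \tr (A *m A^T).
Proof.
apply: eq_bigr => i _; rewrite !mxE; apply: eq_bigr => j _.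
by rewrite !mxE expr2.
Qed.

Lemma sqn_conj n (Q B : 'M[R]_n) : Q^T *m Q = 1%:M -> sqn (Q *m B *m Q^T) = sqn B.
Proof.
move=> QQ; rewrite !sqn_trace.
have -> : Q *m B *m Q^T *m (Q *m B *m Q^T)^T = Q *m (B *m B^T *m Q^T).
  rewrite !trmx_mul trmxK !mulmxA; congr (_ *m _ *m _).
  by rewrite -[_ *m Q^T *m Q]mulmxA QQ mulmx1.
by rewrite mxtrace_mulC -!mulmxA QQ mulmx1.
Qed.

Lemma sqnD_le m n (A B : 'M[R]_(m, n)) : sqn (A + B) <= 2 * sqn A + 2 * sqn B.
Proof.
rewrite /sqn !mulr_sumr -big_split /=; apply: ler_sum => i _.
rewrite !mulr_sumr -big_split /=; apply: ler_sum => j _.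
by rewrite mxE -subr_ge0 (_ : _ - _ = (A i j - B i j) ^+ 2) ?sqr_ge0//; ring.
Qed.

Lemma sqnZ m n (a : R) (A : 'M[R]_(m, n)) : sqn (a *: A) = a ^+ 2 * sqn A.
Proof.
rewrite /sqn mulr_sumr; apply: eq_bigr => i _; rewrite mulr_sumr.
by apply: eq_bigr => j _; rewrite mxE exprMn.
Qed.

Lemma sqnN m n (A : 'M[R]_(m, n)) : sqn (- A) = sqn A.
Proof. by rewrite -scaleN1r sqnZ sqrrN expr1n mul1r. Qed.

End SquaredNorm.

(** * Distance to the rotations and the Gram defect *)

Section DistSO3.
Context {R : realType}.

Lemma SO3_1 : SO3 (1%:M : 'M[R]_3).
Proof. by split; rewrite ?det1// trmx1 mulmx1. Qed.

Lemma SO3_entry_le1 (Q : 'M[R]_3) i j : SO3 Q -> `|Q i j| <= 1.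
Proof.
move=> [QQ _]; rewrite -(ler_pXn2r (n := 2))// ?nnegrE// expr1n real_normK ?num_real//.
have /matrixP/(_ j j) := QQ; rewrite !mxE eqxx mulr1n => <-.
rewrite (bigD1 i)//= !mxE -expr2 lerDl sumr_ge0// => k _.
by rewrite !mxE -expr2 sqr_ge0.
Qed.

(* The identity [A^T A - Q^T Q = A^T (A - Q) + (A - Q)^T Q]. *)
Lemma gram_defect_le (A Q : 'M[R]_3) i j : SO3 Q -> (forall k l, `|A k l| <= 2) ->
  `|(A^T *m A - 1%:M) i j| <= 9 * frob (A - Q).
Proof.
move=> SQ Ale; have [QQ _] := SQ.
have -> : A^T *m A - 1%:M = A^T *m (A - Q) + (A - Q)^T *m Q.
  by rewrite -QQ mulmxBr linearB /= mulmxBl addrA subrK.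
set D := A - Q; rewrite !mxE -big_split /=.
apply: le_trans (ler_norm_sum _ _ _) _.
(* Each of the three terms of the entry costs [2 * frob D] from the first product and [frob D] from
   the second. *)
have -> : 9 * frob D = \sum_(k < 3) 3 * frob D.
  by rewrite sumr_const card_ord; ring.
apply: ler_sum => k _; rewrite !mxE.
apply: le_trans (ler_normD _ _) _; rewrite !normrM.
have := entry_le_frob D k i; have := entry_le_frob D k j.
have := SO3_entry_le1 k j SQ; have := Ale k i.
rewrite /D !mxE => a q h1 h2.
have : `|A k i| * `|A k j - Q k j| <= 2 * frob (A - Q) by apply: ler_pM.
have : `|A k i - Q k i| * `|Q k j| <= frob (A - Q) * 1 by apply: ler_pM.
lra.
Qed.

(** The constant is the same for every rotation, so the bound passes to the infimum. *)
Lemma gram_defect_le_dist (A : 'M[R]_3) i j : (forall k l, `|A k l| <= 2) ->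
  `|(A^T *m A - 1%:M) i j| <= 9 * dist_SO3 A.
Proof.
move=> Ale; rewrite -ler_pdivrMl//; apply: lb_le_inf.
  by exists (frob (A - 1%:M)); exists 1%:M => //; exact: SO3_1.
by move=> _ [Q SQ <-]; rewrite ler_pdivrMl//; exact: gram_defect_le.
Qed.

End DistSO3.

Section HessianAtIdentity.
Context {R : realType}.
Implicit Types (f : 'M[R]_3 -> R) (U : set 'M[R]_3).

(** The differential is linear in the direction at every point of [U]: the inner derivative is
    expanded on the canonical basis in a neighbourhood of the identity, the outer one at the
    identity itself. This polynomial form is the source of the upper bound on [Q3], of its behaviour
    along lines, and of its continuity and measurability. *)
Lemma second_differential_expansion f U : open U -> U 1%:M -> C2_on U f ->
  exists h : 'I_3 -> 'I_3 -> 'I_3 -> 'I_3 -> R, forall B,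
    'D_B (fun A => 'D_B f A) 1%:M =
    \sum_i \sum_j \sum_k \sum_l h i j k l * (B i j * B k l).
Proof.
move=> oU U1 C2f.
pose e i j : 'M[R]_3 := delta_mx i j.
exists (fun i j k l => 'D_(e k l) (fun A => 'D_(e i j) f A) 1%:M) => B.
have dE (g : 'M[R]_3 -> R) A C : differentiable g A ->
    'D_C g A = \sum_k \sum_l C k l * 'D_(e k l) g A.
  move=> dg; rewrite deriveE// {1}(matrix_sum_delta C) linear_sum.
  apply: eq_bigr => k _; rewrite linear_sum; apply: eq_bigr => l _.
  by rewrite linearZ deriveE.
have nU : \forall A \near nbhs (1%:M : 'M[R]_3), U A by exact: open_nbhs_nbhs.
have dg C : differentiable (fun A => 'D_C f A) (1%:M : 'M[R]_3).
  by have [_ + _] := C2f _ U1; exact.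
pose g : 'M[R]_3 -> R := \sum_i \sum_j (B i j \*: (fun A => 'D_(e i j) f A)).
rewrite (near_eq_derive (g := g)); last first.
  near=> A; have UA : U A by near: A.
  have [dfA _ _] := C2f _ UA.
  rewrite dE// /g fct_sumE; apply: eq_bigr => i _; rewrite fct_sumE.
  by apply: eq_bigr => j _.
have dg' i j : derivable (B i j \*: (fun A => 'D_(e i j) f A)) 1%:M B.
  by apply: derivableZ; apply: diff_derivable.
rewrite /g derive_sum; last by move=> i; exact: derivable_sum.
apply: eq_bigr => i _; rewrite derive_sum//; apply: eq_bigr => j _.
rewrite deriveZ; last exact: diff_derivable.
rewrite dE// scaler_sumr; apply: eq_bigr => k _.
rewrite scaler_sumr; apply: eq_bigr => l _.
by rewrite -[_ *: _]/(_ * _); ring.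
Unshelve. all: by end_near. Qed.

Lemma directional_taylor f U B : open U -> U 1%:M -> C2_on U f ->
  exists r : R, [/\ 0 < r,
   forall t : R, `|t| < r -> U (1%:M + t *: B),
   forall t : R, `|t| < r ->
     is_derive t 1 (fun t => f (1%:M + t *: B)) ('D_B f (1%:M + t *: B)) &
   is_derive (0 : R) 1 (fun t => 'D_B f (1%:M + t *: B))
     ('D_B (fun A => 'D_B f A) 1%:M)].
Proof.
move=> oU U1 C2f.
have line (g : 'M[R]_3 -> R) (t : R) : differentiable g (1%:M + t *: B) ->
    is_derive t 1 (fun t => g (1%:M + t *: B)) ('D_B g (1%:M + t *: B)).
  move=> dg.
  have E : (fun h : R => h^-1 *: (((fun t => g (1%:M + t *: B)) \o shift t) (h *: 1)
      - g (1%:M + t *: B))) =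
     (fun h : R => h^-1 *: ((g \o shift (1%:M + t *: B)) (h *: B) - g (1%:M + t *: B))).
    apply/funext => h /=; rewrite [h%:A]mulr1 scalerDl.
    by congr (_ *: (g _ - _)); rewrite addrCA.
  split; rewrite /derivable /derive E //.
  exact: diff_derivable.
have cB : {for (0 : R), continuous (fun t : R => 1%:M + t *: B)}.
  by apply: continuousD; [exact: cst_continuous | exact: scalel_continuous].
have : \forall t \near (0 : R), U (1%:M + t *: B).
  by apply: cB; rewrite scale0r addr0; exact: open_nbhs_nbhs.
move=> /nbhs_ballP[r /= r0 rU].
have Ut t : `|t| < r -> U (1%:M + t *: B).
  by move=> tr; apply: rU; rewrite -ball_normE /ball_ /= sub0r normrN.
exists r; split; [exact: r0 | exact: Ut | |].
  by move=> t tr; apply: line; have [] := C2f _ (Ut _ tr).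
have E0 : 1%:M = 1%:M + (0 : R) *: B by rewrite scale0r addr0.
rewrite {2}E0; apply: line; rewrite -E0.
by have [_ + _] := C2f _ U1; exact.
Qed.

Lemma Q3_expansion (W : 'M[R]_3 -> \bar R) : energy_density W ->
  exists h : 'I_3 -> 'I_3 -> 'I_3 -> 'I_3 -> R, forall B,
    Q3 W B = \sum_i \sum_j \sum_k \sum_l h i j k l * (B i j * B k l).
Proof.
move=> [_ _ _ _ _ [U [oU SU _ C2f]]].
have [h hE] := second_differential_expansion oU (SU _ SO3_1) C2f.
exists (fun i j k l => 2^-1 * h i j k l) => B; rewrite /Q3 hE.
do 4! (rewrite mulr_sumr; apply: eq_bigr => ? _).
exact: mulrA.
Qed.

(** Along [1 + t B] the entry [(i, j)] of the Gram defect is [t s + t^2 w] with [s = B i j + B j i],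
    so the energy is at least [c / 81] times its square, 81 being the square of the constant in the
    Gram estimate. The energy is minimal at the identity, hence has zero slope there, and the
    coefficient of [t^2] bounds the second derivative from below. *)
Lemma Q3_ge_sym (W : 'M[R]_3 -> \bar R) : energy_density W ->
  exists2 c : R, 0 < c & forall (B : 'M[R]_3) i j, c * (B i j + B j i) ^+ 2 <= Q3 W B.
Proof.
move=> [W0 _ _ WSO [c c0 Wc] [U [oU SU Ufin C2f]]].
exists (2^-1 * (c / 81)); first by rewrite mulr_gt0// divr_gt0.
move=> B i j; rewrite /Q3 -mulrA ler_pM2l//.
have [r [r0 Ur Dphi Ddphi]] := directional_taylor B oU (SU _ SO3_1) C2f.
set f := (fun X => fine (W X)) in Dphi Ddphi *.
pose M := \sum_i \sum_j `|B i j|.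
have M0 : 0 <= M by apply: sumr_ge0 => ? _; apply: sumr_ge0.
have BM k l : `|B k l| <= M.
  rewrite /M (bigD1 k)//= (bigD1 l)//= -addrA lerDl addr_ge0//.
    by apply: sumr_ge0.
  by apply: sumr_ge0 => ? _; apply: sumr_ge0.
pose s := B i j + B j i.
pose w := (B^T *m B) i j.
(* The bound by [(1 + M)^-1] keeps the entries of [1 + t B] at most 2, as the Gram estimate
   demands. *)
pose rho := Num.min r (1 + M)^-1.
have rho0 : 0 < rho by rewrite lt_min r0 invr_gt0 ltr_pwDl.
have f0 : f 1%:M = 0.
  by rewrite /f (WSO 1%:M).2//; exact: SO3_1.
have f_ge0 X : 0 <= f X by rewrite fine_ge0.
have E0 : 1%:M + (0 : R) *: B = 1%:M by rewrite scale0r addr0.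
have phi0 : is_derive (0 : R) 1 (fun t => f (1%:M + t *: B)) 0.
  apply: (@derive1_at_min _ _ (- r) r); first by lra.
  - by move=> t; rewrite in_itv/= -ltr_norml => /Dphi[].
  - by rewrite in_itv/= oppr_lt0 r0.
  - by move=> t _; rewrite E0 f0.
(* The cubic coefficient is the cross term of [(t s + t^2 w)^2]; the quartic term is nonnegative and
   is dropped. *)
apply: (@second_derivative_ge R (fun t => f (1%:M + t *: B))
  (fun t => 'D_B f (1%:M + t *: B)) _ _ (- (c / 81 * (2 * s * w))) rho rho0) => //.
- by rewrite mulr_ge0 ?sqr_ge0// divr_ge0// ltW.
- move=> t; rewrite in_itv/= -ltr_norml lt_min => /andP[tr _].
  exact: Dphi.
- by rewrite E0.
- rewrite E0; have := Dphi 0; rewrite normr0 => /(_ r0)[_].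
  by rewrite E0 => <-; case: phi0.
move=> t; rewrite in_itv/= lt_min => /andP[t0 /andP[tr tM]].
have tr' : `|t| < r by rewrite gtr0_norm.
have UX := Ur _ tr'; set X := 1%:M + t *: B in UX *.
have Xle k l : `|X k l| <= 2.
  rewrite !mxE (le_trans (ler_normD _ _))// (_ : 2 = 1 + 1 :> R) ?lerD//.
    by case: (k == l); rewrite ?normr1 ?normr0.
  rewrite normrM gtr0_norm// (@le_trans _ _ ((1 + M)^-1 * (1 + M)))//.
    by rewrite ler_pM// ?ltW// (le_lt_trans (BM _ _))// ltrDr.
  by rewrite mulVf// gt_eqF// ltr_pwDl.
have XX : (X^T *m X - 1%:M) i j = t * (s + t * w).
  have XT : X^T = 1%:M + t *: B^T.
    by apply/matrixP => k l; rewrite !mxE eq_sym.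
  rewrite XT /X mulmxDl mul1mx mulmxDr mulmx1 -scalemxAl -scalemxAr /s /w.
  by rewrite !mxE; ring.
have dX := gram_defect_le_dist i j Xle; rewrite XX in dX.
have : c * dist_SO3 X ^+ 2 <= f X.
  have := Wc X; rewrite -(fineK (Ufin _ UX)) lee_fin; exact.
apply: le_trans.
have d2 : (t * (s + t * w)) ^+ 2 <= 81 * dist_SO3 X ^+ 2.
  rewrite -real_normK ?num_real// (_ : 81 * _ = (9 * dist_SO3 X) ^+ 2); last by ring.
  by rewrite ler_sqr// nnegrE; apply: le_trans dX.
apply: (@le_trans _ _ (c / 81 * (t * (s + t * w)) ^+ 2)); last first.
  by rewrite -mulrA ler_pM2l// ler_pdivrMl.
rewrite -[X in X - _ <= _]mulrA -mulNr opprK -[X in _ + X <= _]mulrA -mulrDr.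
rewrite ler_pM2l ?divr_gt0// -subr_ge0 (_ : _ - _ = (t ^+ 2 * w) ^+ 2) ?sqr_ge0// /s.
by ring.
Qed.

End HessianAtIdentity.

(** * The frame is orthogonal *)

Section Frame.
Context {R : realType}.
Variables (L : R) (kappa : R -> R) (II0 : R -> 'M[R]_2) (e1 e2 e3 : R -> 'cV[R]_3).
Hypothesis L0 : 0 < L.
Hypothesis fr : is_frame L kappa II0 e1 e2 e3.
Hypothesis fr0 : SO3 (frame_mx e1 e2 e3 0).

Lemma frame_mxE x i j : frame_mx e1 e2 e3 x i j =
  (if j == 0 :> nat then e1 x i 0 else if j == 1 :> nat then e2 x i 0 else e3 x i 0).
Proof.
rewrite /frame_mx; case: (@split_ordP 1 2 j) => k ->.
  by apply: etrans (row_mxEl _ _ _ _) _; rewrite !ord1.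
case: (@split_ordP 1 1 k) => l ->; apply: etrans (row_mxEr _ _ _ _) _.
  by apply: etrans (row_mxEl _ _ _ _) _; rewrite !ord1.
by apply: etrans (row_mxEr _ _ _ _) _; rewrite !ord1.
Qed.

Lemma is_derive_entry m n (e : R -> 'M[R]_(m, n)) (x : R) (de : 'M[R]_(m, n)) i j :
  is_derive x 1 e de -> is_derive x 1 (fun y => e y i j) (de i j).
Proof.
move=> [de1 deE]; split; first by move/derivable_mxP : de1.
by rewrite -deE derive_mx// mxE.
Qed.

Lemma within_continuous_entry m n (A : set R) (e : R -> 'M[R]_(m, n)) i j :
  {within A, continuous e} -> {within A, continuous (fun y => e y i j)}.
Proof.
move=> ce x.
apply: (@continuous_comp _ _ _ (e : subspace A -> 'M[R]_(m, n))
  (fun M : 'M[R]_(m, n) => M i j)); first exact: ce.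
exact: coord_continuous.
Qed.

Lemma within_continuousM (A : set R) (f g : R -> R) :
  {within A, continuous f} -> {within A, continuous g} ->
  {within A, continuous (fun x => f x * g x)}.
Proof. by move=> cf cg x; apply: (continuousM (cf x) (cg x)). Qed.

(** With [F] the frame matrix, the system reads [F' = F S] with [S] antisymmetric, so
    [(F F^T)' = F (S + S^T) F^T = 0] and every entry of [F F^T] is constant. The derivative of
    [F^T F] is the commutator of [F^T F] with [S], which would call for uniqueness in a linear
    system; hence the passage to the other product. *)
Lemma frame_orthogonal x : x \in `[0, L] ->
  (frame_mx e1 e2 e3 x)^T *m frame_mx e1 e2 e3 x = 1%:M.
Proof.
rewrite in_itv/= => /andP[x0 xL]; apply: mulmx1C.
have [c1 c2 c3 De] := fr.
have [/mulmx1C F0 _] := fr0; rewrite -F0.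
apply/matrixP => i j.
pose s (y : R) := e1 y i 0 * e1 y j 0 + (e2 y i 0 * e2 y j 0 + e3 y i 0 * e3 y j 0).
have sE y : (frame_mx e1 e2 e3 y *m (frame_mx e1 e2 e3 y)^T) i j = s y.
  rewrite mxE; under eq_bigr => k _ do rewrite [X in _ * X]mxE !frame_mxE.
  by rewrite !big_ord_recl big_ord0 addr0.
rewrite !sE.
have Ds y : y \in `]0, x[ -> is_derive y 1 s 0.
  rewrite in_itv/= => /andP[y0 yx].
  have [|D1 D2 D3] := De y; first by rewrite in_itv/= y0 (lt_le_trans yx).
  have D1i := is_derive_entry i 0 D1; have D1j := is_derive_entry j 0 D1.
  have D2i := is_derive_entry i 0 D2; have D2j := is_derive_entry j 0 D2.
  have D3i := is_derive_entry i 0 D3; have D3j := is_derive_entry j 0 D3.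
  have D := is_deriveD (is_deriveM D1i D1j) (is_deriveD (is_deriveM D2i D2j) (is_deriveM D3i D3j)).
  case: D => Dd DE; split; first exact: Dd.
  apply: etrans DE _.
  by rewrite !mxE -![_ *: _]/(_ * _); ring.
have cs : {within `[0, x], continuous s}.
  have sub : `[0, x] `<=` `[0, L].
    by move=> y /=; rewrite !in_itv/= => /andP[-> yx]; rewrite (le_trans yx).
  have ce (e : R -> 'cV[R]_3) k : {within `[0, L], continuous e} ->
      {within `[0, x], continuous (fun y => e y k 0)}.
    by move=> /(continuous_subspaceW sub)/within_continuous_entry; exact.
  apply: within_continuousD; first by apply: within_continuousM; exact: ce.
  by apply: within_continuousD; apply: within_continuousM; exact: ce.
have := x0; rewrite le_eqVlt => /orP[/eqP <-//|xgt0].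
have [c _] := MVT xgt0 Ds cs.
by rewrite mul0r => /eqP; rewrite subr_eq0 => /eqP.
Qed.

Lemma frame_entry_continuous i j (x : R) : x \in `]0, L[ ->
  {for x, continuous (fun y => frame_mx e1 e2 e3 y i j)}.
Proof.
move=> xL; have [_ _ _ /(_ _ xL)[D1 D2 D3]] := fr.
have ce (e : R -> 'cV[R]_3) de k : is_derive x 1 e de ->
    {for x, continuous (fun y => e y k 0)}.
  move=> /(is_derive_entry k 0)[d _].
  exact/differentiable_continuous/derivable1_diffP.
have -> : (fun y => frame_mx e1 e2 e3 y i j) =
    (if j == 0 :> nat then fun y => e1 y i 0
     else if j == 1 :> nat then fun y => e2 y i 0 else fun y => e3 y i 0).
  by apply/funext => y; rewrite frame_mxE; case: ifP => // _; case: ifP.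
by case: ifP => _; [exact: ce D1 | case: ifP => _; [exact: ce D2 | exact: ce D3]].
Qed.

End Frame.

(** * The relaxed quadratic form *)

Section Mx2.
Context {R : realType}.

Lemma sqn2E (A : 'M[R]_2) :
  sqn A = A 0 0 ^+ 2 + A 0 1 ^+ 2 + A 1 0 ^+ 2 + A 1 1 ^+ 2.
Proof.
rewrite /sqn !big_ord_recl !big_ord0 (_ : lift ord0 ord0 = 1); last exact: val_inj.
by rewrite !addr0 !addrA.
Qed.

Lemma det_mx2 (A : 'M[R]_2) : \det A = A 0 0 * A 1 1 - A 0 1 * A 1 0.
Proof.
rewrite (expand_det_row _ 0) !big_ord_recl big_ord0 /cofactor !det_mx11 !mxE /=.
have l1 : lift ord0 ord0 = 1 :> 'I_2 by exact: val_inj.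
have l2 : lift 1 0 = 0 :> 'I_2 by exact: val_inj.
have l3 : lift 0 0 = 1 :> 'I_2 by exact: val_inj.
by rewrite !(l1, l2, l3) !addn0 !add0n expr0 expr1; ring.
Qed.

Lemma sym2E (A : 'M[R]_2) : A^T = A -> A 1 0 = A 0 1.
Proof. by move=> /matrixP/(_ 0 1); rewrite mxE. Qed.

Lemma det_le_sqn (A : 'M[R]_2) : `|\det A| <= sqn A.
Proof.
rewrite det_mx2 sqn2E; set a := A 0 0; set b := A 0 1; set c := A 1 0; set d := A 1 1.
have := sqr_ge0 (a + d); have := sqr_ge0 (a - d).
have := sqr_ge0 (b + c); have := sqr_ge0 (b - c).
have := sqr_ge0 a; have := sqr_ge0 b; have := sqr_ge0 c; have := sqr_ge0 d.
move=> ? ? ? ? ? ? ? ?; rewrite ler_norml; apply/andP; split; lra.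
Qed.

Lemma sqn_block22_le (B : 'M[R]_3) : sqn (block22 B) <= sqn B.
Proof.
have -> : sqn B = \sum_(i < 2 + 1) \sum_(j < 2 + 1) B i j ^+ 2 by [].
rewrite big_split_ord /=; apply: ler_wpDr.
  by apply: sumr_ge0 => i _; apply: sumr_ge0 => j _; exact: sqr_ge0.
apply: ler_sum => i _; rewrite big_split_ord /=; apply: ler_wpDr.
  by apply: sumr_ge0 => j _; exact: sqr_ge0.
by apply: ler_sum => j _; rewrite /block22 !mxE.
Qed.

(** The simplest completion in the infimum defining [Q2]; padding by zeros preserves the squared
    norm. *)
Definition ext33 (A : 'M[R]_2) : 'M[R]_3 := @block_mx R 2 1 2 1 A 0 0 0.

Lemma block22_ext33 A : block22 (ext33 A) = A.
Proof. exact: block_mxKul. Qed.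

Lemma block22D B B' : block22 (B + B') = block22 B + block22 B' :> 'M[R]_2.
Proof. by apply/matrixP => i j; rewrite !mxE. Qed.

Lemma ext33_ul A (i j : 'I_2) : ext33 A (lshift 1 i) (lshift 1 j) = A i j.
Proof. exact: block_mxEul. Qed.

Lemma ext33_ur A (i : 'I_2) (j : 'I_1) : ext33 A (lshift 1 i) (rshift 2 j) = 0.
Proof. exact: etrans (block_mxEur _ _ _ _ _ _) (mxE _ _ _ _). Qed.

Lemma ext33_dl A (i : 'I_1) (j : 'I_2) : ext33 A (rshift 2 i) (lshift 1 j) = 0.
Proof. exact: etrans (block_mxEdl _ _ _ _ _ _) (mxE _ _ _ _). Qed.

Lemma ext33_dr A (i j : 'I_1) : ext33 A (rshift 2 i) (rshift 2 j) = 0.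
Proof. exact: etrans (block_mxEdr _ _ _ _ _ _) (mxE _ _ _ _). Qed.

Definition ext33E := (ext33_ul, ext33_ur, ext33_dl, ext33_dr).

Lemma ext33B A A' : ext33 (A - A') = ext33 A - ext33 A'.
Proof.
apply/matrixP => i j; rewrite [RHS]mxE [X in _ = _ + X]mxE.
by case: (@split_ordP 2 1 i) => k ->; case: (@split_ordP 2 1 j) => l ->;
  rewrite !ext33E ?subrr// !mxE.
Qed.

Lemma sqn_ext33 A : sqn (ext33 A) = sqn A.
Proof.
have -> : sqn (ext33 A) = \sum_(i < 2 + 1) \sum_(j < 2 + 1) ext33 A i j ^+ 2 by [].
rewrite big_split_ord /= [X in _ + X]big1 ?addr0; last first.
  by move=> i _; rewrite big_split_ord /= !big1 ?addr0// => j _; rewrite ext33E expr0n.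
apply: eq_bigr => i _; rewrite big_split_ord /= [X in _ + X]big1 ?addr0; last first.
  by move=> j _; rewrite ext33E expr0n.
by apply: eq_bigr => j _; rewrite ext33E.
Qed.

End Mx2.

(** * Growth, coercivity and almost-convexity of the relaxed form; bounds on the alphas *)

Section Quadratic.
Context {R : realType}.

(** Young's inequality: nonnegativity of [a ^+ 2 * u + a * b + v] at [a = - e] bounds the cross term
    by [e * u + e^-1 * v]. *)
Lemma pencil_le (u v b e : R) : 0 < e -> 0 <= e ^+ 2 * u - e * b + v ->
  u + b + v <= (1 + e) * u + (1 + e^-1) * v.
Proof.
move=> e0; rewrite -(ler_pM2l e0) mulr0 => H.
rewrite -(ler_pM2l (mulr_gt0 e0 e0)) -subr_ge0; apply: le_trans H _.
rewrite le_eqVlt; apply/orP; left; apply/eqP.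
by field; rewrite gt_eqF.
Qed.

Variables (W : 'M[R]_3 -> \bar R) (h : 'I_3 -> 'I_3 -> 'I_3 -> 'I_3 -> R) (c0 : R).
Hypothesis hE : forall B,
  Q3 W B = \sum_i \sum_j \sum_k \sum_l h i j k l * (B i j * B k l).
Hypothesis c0_gt0 : 0 < c0.
Hypothesis Q3_coer : forall (B : 'M[R]_3) i j, c0 * (B i j + B j i) ^+ 2 <= Q3 W B.

Definition Cq : R := \sum_i \sum_j \sum_k \sum_l `|h i j k l|.

Lemma Q3_ge0 B : 0 <= Q3 W B.
Proof. by apply: le_trans (Q3_coer B 0 0); rewrite mulr_ge0 ?sqr_ge0// ltW. Qed.

Lemma Q3_le B : Q3 W B <= Cq * sqn B.
Proof.
rewrite hE /Cq mulr_suml; apply: ler_sum => i _; rewrite mulr_suml.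
apply: ler_sum => j _; rewrite mulr_suml; apply: ler_sum => k _.
rewrite mulr_suml; apply: ler_sum => l _.
apply: le_trans (ler_norm _) _; rewrite normrM ler_wpM2l//.
have := sqr_entry_le_sqn B i j; have := sqr_entry_le_sqn B k l.
have := sqr_ge0 (B i j + B k l); have := sqr_ge0 (B i j - B k l).
move=> ? ? ? ?; rewrite ler_norml; apply/andP; split; lra.
Qed.

Lemma Q3_pencil X Y : exists b, forall a, Q3 W (a *: X + Y) =
  a ^+ 2 * Q3 W X + a * b + Q3 W Y.
Proof.
exists (\sum_i \sum_j \sum_k \sum_l h i j k l * (X i j * Y k l + Y i j * X k l)).
move=> a; rewrite !hE.
do 4! (rewrite !mulr_sumr -!big_split; apply: eq_bigr => ? _).
by rewrite !mxE /=; ring.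
Qed.

Lemma Q3D_le X Y e : 0 < e ->
  Q3 W (X + Y) <= (1 + e) * Q3 W X + (1 + e^-1) * Q3 W Y.
Proof.
move=> e0; have [b bE] := Q3_pencil X Y.
have := bE 1; rewrite scale1r expr1n !mul1r => ->.
by apply: pencil_le => //; rewrite -sqrrN -mulNr -bE; exact: Q3_ge0.
Qed.

Variables (Q0 : R -> 'M[R]_3) (x : R).
Hypothesis Q0x : (Q0 x)^T *m Q0 x = 1%:M.

Let cj (B : 'M[R]_3) := Q0 x *m B *m (Q0 x)^T.

Let cjD B B' : cj (B + B') = cj B + cj B'.
Proof. by rewrite /cj mulmxDr mulmxDl. Qed.

Lemma Q2_le_Q3 B : Q2 W Q0 x (block22 B) <= Q3 W (cj B).
Proof.
apply: ge_inf; last by exists B.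
by exists 0 => _ [B' _ <-]; exact: Q3_ge0.
Qed.

Lemma Q2_ge A m : (forall B, block22 B = A -> m <= Q3 W (cj B)) -> m <= Q2 W Q0 x A.
Proof.
move=> mB; apply: lb_le_inf; last by move=> _ [B BA <-]; exact: mB.
by exists (Q3 W (cj (ext33 A))); exists (ext33 A) => //=; exact: block22_ext33.
Qed.

#[local] Opaque Q2 Q3.

(** Strict inequalities turn the infimum into the existence of a completion; this is the access to
    near-optimal completions used throughout. *)
Lemma Q2_lt A m : Q2 W Q0 x A < m <-> exists2 B, block22 B = A & Q3 W (cj B) < m.
Proof.
split=> [Am|[B <- Bm]]; last exact: le_lt_trans (Q2_le_Q3 B) Bm.
apply: contrapT => nB; move: Am; apply/negP; rewrite -leNgt; apply: Q2_ge => B BA.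
by rewrite leNgt; apply/negP => Bm; apply: nB; exists B.
Qed.

Lemma Q2_ge0 A : 0 <= Q2 W Q0 x A.
Proof. by apply: Q2_ge => B _; exact: Q3_ge0. Qed.

Lemma Q2_le A : Q2 W Q0 x A <= Cq * sqn A.
Proof.
rewrite -{1}(block22_ext33 A); apply: le_trans (Q2_le_Q3 _) _.
by apply: le_trans (Q3_le _) _; rewrite sqn_conj// sqn_ext33.
Qed.

(** Summing the entrywise coercivity over nine entries costs the factor 9. Conjugation by an
    orthogonal matrix preserves the norm of [B + B^T], and the upper left block of this sum is [2 A]
    for every completion [B] of the symmetric matrix [A]; the resulting factor 4 is discarded. *)
Lemma Q2_coer A : A^T = A -> c0 / 9 * sqn A <= Q2 W Q0 x A.
Proof.
move=> AT; apply: Q2_ge => B BA.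
suff : c0 * sqn (cj B + (cj B)^T) <= 9 * Q3 W (cj B).
  have -> : cj B + (cj B)^T = cj (B + B^T).
    by rewrite /cj !trmx_mul trmxK mulmxDr mulmxDl mulmxA.
  rewrite [sqn (cj _)]sqn_conj// => H.
  rewrite -mulrA mulrCA ler_pdivrMl//; apply: le_trans H; rewrite ler_pM2l//.
  apply: le_trans (sqn_block22_le _).
  have -> : block22 (B + B^T) = 2%:R *: A.
    rewrite block22D BA (_ : block22 B^T = A); last first.
      by rewrite -[RHS]AT -BA; apply/matrixP => i j; rewrite !mxE.
    by rewrite scaler_nat mulr2n.
  by rewrite sqnZ ler_peMl ?sqn_ge0// expr_ge1// ler1n.
rewrite /sqn mulr_sumr (_ : 9 * _ = \sum_(i < 3) \sum_(j < 3) Q3 W (cj B)); last first.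
  by rewrite !sumr_const !card_ord; ring.
apply: ler_sum => i _; rewrite mulr_sumr; apply: ler_sum => j _.
by rewrite mxE [X in _ + X]mxE; exact: Q3_coer.
Qed.

(** Near-optimal completions of [A] and [A'] add up to a completion of [A + A'], so Young's
    inequality for [Q3] passes to the infimum. The margins are divided by the weights so that each
    contributes [d / 2]. *)
Lemma Q2D_le A A' e : 0 < e -> Q2 W Q0 x (A + A') <=
  (1 + e) * Q2 W Q0 x A + (1 + e^-1) * Q2 W Q0 x A'.
Proof.
move=> e0; have e1 : 0 < 1 + e by rewrite ltr_pwDl// ltW.
have e2 : 0 < 1 + e^-1 by rewrite ltr_pwDl// invr_ge0 ltW.
apply/ler_addgt0Pr => d d0.
have [B <- Bd] : exists2 B, block22 B = A & Q3 W (cj B) < Q2 W Q0 x A + d / (2 * (1 + e)).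
  by apply/Q2_lt; rewrite ltrDl divr_gt0// mulr_gt0.
have [B' <- Bd'] : exists2 B, block22 B = A' & Q3 W (cj B) < Q2 W Q0 x A' + d / (2 * (1 + e^-1)).
  by apply/Q2_lt; rewrite ltrDl divr_gt0// mulr_gt0.
rewrite -block22D; apply: le_trans (Q2_le_Q3 _) _; rewrite cjD.
apply: le_trans (Q3D_le _ _ e0) _.
have scale a p q : 0 < a -> q < p + d / (2 * a) -> a * q <= a * p + d / 2.
  move=> a0; rewrite -(ltr_pM2l a0) mulrDr => /ltW/le_trans; apply.
  by rewrite lerD2l le_eqVlt; apply/orP; left; apply/eqP; field; rewrite gt_eqF.
apply: le_trans (lerD (scale _ _ _ e1 Bd) (scale _ _ _ e2 Bd')) _.
by rewrite addrACA -splitr.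
Qed.




Lemma Q2D2_le A A' : Q2 W Q0 x (A + A') <= 2 * Q2 W Q0 x A + 2 * Q2 W Q0 x A'.
Proof. by have := Q2D_le A A' (@ltr01 R); rewrite invr1. Qed.

(** The sign [s] treats both suprema at once: 1 gives [alpha_plus], -1 gives [alpha_minus]. *)
Definition alpha_set (s : R) : set R := [set a : R | 0 < a /\
  forall M : 'M[R]_2, M^T = M -> 0 <= Q2 W Q0 x M + a * (s * \det M)].

Lemma alpha_plusE : alpha_plus W Q0 x = sup (alpha_set 1).
Proof.
congr (sup _); apply/seteqP; split=> a [a0 aM]; split=> // M MT; have := aM M MT;
  by rewrite mul1r.
Qed.

Lemma alpha_minusE : alpha_minus W Q0 x = sup (alpha_set (-1)).
Proof.
congr (sup _); apply/seteqP; split=> a [a0 aM]; split=> // M MT; have := aM M MT;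
  by rewrite mulN1r mulrN.
Qed.

Lemma alpha_set_down s a b : alpha_set s b -> 0 < a -> a <= b -> alpha_set s a.
Proof.
move=> [b0 bM] a0 ab; split=> // M MT; have QM := Q2_ge0 M.
have [dM|dM] := leP 0 (s * \det M).
  by apply: addr_ge0 => //; apply: mulr_ge0 => //; exact: ltW.
apply: le_trans (bM _ MT) _; rewrite lerD2l.
by rewrite ler_nM2r.
Qed.

Lemma alpha_set_coer s : `|s| <= 1 -> alpha_set s (c0 / 9).
Proof.
move=> s1; split; first by rewrite divr_gt0.
move=> M MT; apply: (@le_trans _ _ (c0 / 9 * sqn M + c0 / 9 * (s * \det M))).
  rewrite -mulrDr; apply: mulr_ge0; first by rewrite divr_ge0// ltW.
  rewrite -lerBlDr sub0r; apply: le_trans (det_le_sqn M).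
  apply: le_trans (ler_norm _) _; rewrite normrN normrM.
  by rewrite -[leRHS]mul1r ler_wpM2r.
by rewrite lerD2r; exact: Q2_coer.
Qed.

(** Testing the constraint on [diag(1, - s)], whose determinant has the sign opposite to [s], bounds
    [a] by the value of [Q2] there. *)
Lemma alpha_set_ubound s : s = 1 \/ s = -1 -> ubound (alpha_set s) (2 * Cq).
Proof.
move=> s1 a [a0 aM].
pose M : 'M[R]_2 := diag_mx (\row_j (if j == 0 then 1 else - s)).
have MT : M^T = M by rewrite tr_diag_mx.
have dM : s * \det M = -1.
  rewrite det_diag big_ord_recl big_ord1 !mxE /=.
  by case: s1 => ->; ring.
have sM : sqn M = 2.
  rewrite sqn2E !mxE /= !mulr1n !mulr0n expr0n !addr0 expr1n.
  by case: s1 => ->; ring.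
have := aM M MT; rewrite dM mulrN1 subr_ge0 => /le_trans; apply.
by apply: le_trans (Q2_le _) _; rewrite sM mulrC.
Qed.

Lemma alpha_bounds s : s = 1 \/ s = -1 -> c0 / 9 <= sup (alpha_set s) <= 2 * Cq.
Proof.
move=> s1; have ub := alpha_set_ubound s1.
have c9 : alpha_set s (c0 / 9).
  by apply: alpha_set_coer; case: s1 => ->; rewrite ?normrN normr1.
apply/andP; split; first by apply: ub_le_sup => //; exists (2 * Cq).
by apply: ge_sup => //; exists (c0 / 9).
Qed.

End Quadratic.

(** * Measurability *)

Section MeasurableInf.
Context {R : realType}.
Implicit Types (D : set R) (f : R -> R).

Lemma measurable_fun_ltP D f :
  (forall a, measurable (D `&` [set x | f x < a])) -> measurable_fun D f.
Proof.
move=> mf mD; apply: (measurability _ (RGenInftyO.measurableE R)) => //.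
by move=> _ [_ [a ->] <-]; rewrite preimage_itvNyo.
Qed.

(** The second hypothesis expresses that [f] is the infimum of the family through strict sublevel
    sets, which makes each of them a countable union. *)
Lemma measurable_fun_countable_inf D (I : countType) (F : I -> R -> R) f :
  (forall i, measurable_fun D (F i)) ->
  (forall x a, D x -> f x < a <-> exists i, F i x < a) -> measurable_fun D f.
Proof.
move=> mF fF mD; apply: measurable_fun_ltP => // a.
rewrite (_ : _ `&` _ = \bigcup_i (D `&` [set x | F i x < a])); last first.
  apply/seteqP; split=> [x [Dx /(fF _ _ Dx)[i Fi]]|x [i _ [Dx Fi]]].
    by exists i.
  by split=> //; apply/(fF _ _ Dx); exists i.
apply: countable_bigcupT_measurable => // i.
rewrite -preimage_itvNyo; exact: mF.
Qed.

Lemma open_preimage_lt D f a : open D -> (forall x, D x -> {for x, continuous f}) ->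
  open (D `&` [set x | f x < a]).
Proof.
move=> oD cf; rewrite openE => x [Dx fxa].
have /cvgrPdist_lt/(_ (a - f x)) := cf x Dx; rewrite subr_gt0 => /(_ fxa) fnear.
have nD : nbhs x D by exact: open_nbhs_nbhs.
rewrite /interior; near=> y; split; first by near: y.
have : `|f x - f y| < a - f x by near: y.
by rewrite distrC => /(le_lt_trans (ler_norm _)); rewrite ltrD2r.
Unshelve. all: by end_near. Qed.

Lemma rat_mx_dense m n (B : 'M[R]_(m, n)) d : 0 < d ->
  exists P : 'M[rat]_(m, n), sqn (map_mx ratr P - B) <= d.
Proof.
move=> d0; pose N : R := (m * n).+1%:R.
have N0 : 0 < N by rewrite ltr0n.
(* As [e <= 1], each squared entry error is at most [e]. The successor in [N] keeps the denominator
   positive for empty matrices. *)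
pose e := Num.min 1 (d / N).
have e0 : 0 < e by rewrite lt_min ltr01 divr_gt0.
have ex i j : exists q : rat, B i j - e < ratr q < B i j + e.
  have /rat_in_itvoo[q] : B i j - e < B i j + e by lra.
  by rewrite in_itv/=; exists q.
exists (\matrix_(i, j) xget 0 [set q | B i j - e < ratr q < B i j + e]).
apply: (@le_trans _ _ (\sum_(i < m) \sum_(j < n) e)).
  apply: ler_sum => i _; apply: ler_sum => j _; rewrite !mxE.
  case: xgetP => [q _|nq]; last by case: (ex i j) => q /nq.
  move=> /andP[lo hi].
  have : `|ratr q - B i j| <= e by rewrite ler_norml; apply/andP; split; lra.
  move=> qe; rewrite -real_normK ?num_real// -[leRHS]mulr1 expr2.
  by rewrite ler_pM// (le_trans qe)// /e ge_min lexx.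
rewrite !sumr_const !card_ord -mulrnA -mulr_natr.
apply: (@le_trans _ _ (e * N)); first by rewrite ler_pM2l// ler_nat mulnC.
by rewrite -ler_pdivlMr// /e ge_min lexx orbT.
Qed.

End MeasurableInf.

Section MeasurableQ2.
Context {R : realType}.
Variables (W : 'M[R]_3 -> \bar R) (h : 'I_3 -> 'I_3 -> 'I_3 -> 'I_3 -> R) (c0 : R).
Hypothesis hE : forall B,
  Q3 W B = \sum_i \sum_j \sum_k \sum_l h i j k l * (B i j * B k l).
Hypothesis c0_gt0 : 0 < c0.
Hypothesis Q3_coer : forall (B : 'M[R]_3) i j, c0 * (B i j + B j i) ^+ 2 <= Q3 W B.
Variables (Q0 : R -> 'M[R]_3) (D : set R).
Hypothesis oD : open D.
Hypothesis Q0D : forall x, D x -> (Q0 x)^T *m Q0 x = 1%:M.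
Hypothesis cQ0 : forall x i j, D x -> {for x, continuous (fun y => Q0 y i j)}.

Lemma conj_mxE (Q B : 'M[R]_3) i j :
  (Q *m B *m Q^T) i j = \sum_k (\sum_l Q i l * B l k) * Q j k.
Proof. by rewrite mxE; apply: eq_bigr => k _; rewrite !mxE. Qed.

Lemma continuous_Q3_conj B x : D x ->
  {for x, continuous (fun y => Q3 W (Q0 y *m B *m (Q0 y)^T))}.
Proof.
move=> Dx.
have cS n (F : 'I_n -> R -> R) : (forall i, {for x, continuous (F i)}) ->
    {for x, continuous (fun y => \sum_i F i y)}.
  by move=> cF; apply: cvg_big => [|i _]; [exact: add_continuous | exact: cF].
have cj i j : {for x, continuous (fun y => (Q0 y *m B *m (Q0 y)^T) i j)}.
  rewrite (_ : (fun y => _) = fun y => \sum_k (\sum_l Q0 y i l * B l k) * Q0 y j k).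
    apply: (cS _ (fun k y => _)) => k; apply: continuousM; last exact: cQ0.
    apply: (cS _ (fun l y => _)) => l; apply: continuousM; first exact: cQ0.
    exact: cst_continuous.
  by apply/funext => y; rewrite conj_mxE.
rewrite (_ : (fun y => _) = fun y => \sum_i \sum_j \sum_k \sum_l h i j k l *
    ((Q0 y *m B *m (Q0 y)^T) i j * (Q0 y *m B *m (Q0 y)^T) k l)).
  do 4! apply: (cS _ (fun k y => _)) => ?.
  by apply: continuousM; [exact: cst_continuous | apply: continuousM; exact: cj].
by apply/funext => y; rewrite hE.
Qed.

Lemma measurable_Q0 i j : measurable_fun D (fun x => Q0 x i j).
Proof.
apply: open_continuous_measurable_fun => // x; rewrite inE => Dx; exact: cQ0.
Qed.

Lemma measurable_Q3_conj (F : R -> 'M[R]_3) :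
  (forall i j, measurable_fun D (fun x => F x i j)) ->
  measurable_fun D (fun x => Q3 W (Q0 x *m F x *m (Q0 x)^T)).
Proof.
move=> mF.
have mj i j : measurable_fun D (fun y => (Q0 y *m F y *m (Q0 y)^T) i j).
  under eq_fun do rewrite conj_mxE.
  apply: measurable_sum => k; apply: measurable_funM; last exact: measurable_Q0.
  apply: measurable_sum => l; apply: measurable_funM => //; exact: measurable_Q0.
under eq_fun do rewrite hE.
do 4! apply: measurable_sum => ?.
by apply: measurable_funM => //; apply: measurable_funM; exact: mj.
Qed.

(** The supremum is below [a] exactly when some level [b < a] is violated, that is, when a pair
    [(b, B)] exists where [B] completes a symmetric matrix breaking the constraint. The union over
    these pairs is uncountable, but each member is open in [x] because the frame is continuous, so
    the union is open. *)
Lemma measurable_alpha s : s = 1 \/ s = -1 ->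
  measurable_fun D (fun x => sup (alpha_set W Q0 x s)).
Proof.
move=> s1; apply: measurable_fun_ltP => a; apply: open_measurable.
pose I := {t : R * 'M[R]_3 | [/\ 0 < t.1, t.1 < a & (block22 t.2)^T = block22 t.2]}.
pose G (t : I) := D `&` [set x | Q3 W (Q0 x *m (sval t).2 *m (Q0 x)^T)
  + (sval t).1 * (s * \det (block22 (sval t).2)) < 0].
rewrite (_ : _ `&` _ = \bigcup_t G t); last first.
  apply/seteqP; split=> [x [Dx /= xa]|x [[[b B] /= [b0 ba BT]] _ [Dx /= H]]]; last first.
    split=> //=; apply: le_lt_trans ba; apply: ge_sup.
      exists (c0 / 9); apply: (alpha_set_coer c0_gt0 Q3_coer (Q0D Dx)).
      by case: s1 => ->; rewrite ?normrN normr1.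
    move=> b' b'S; rewrite leNgt; apply/negP => bb'.
    have [_ /(_ _ BT)] := alpha_set_down c0_gt0 Q3_coer b'S b0 (ltW bb').
    apply/negP; rewrite -ltNge; apply: le_lt_trans H; rewrite lerD2r.
    exact: (Q2_le_Q3 c0_gt0 Q3_coer).
  have /andP[lo up] := alpha_bounds hE c0_gt0 Q3_coer (Q0D Dx) s1.
  set al := sup _ in xa lo up.
  have al0 : 0 < al by apply: lt_le_trans lo; rewrite divr_gt0.
  (* Above the supremum, hence violated, and still below [a]. *)
  pose b := (al + a) / 2.
  have alb : al < b by rewrite /b; lra.
  have ba : b < a by rewrite /b; lra.
  have nb : ~ alpha_set W Q0 x s b.
    move=> bS; move: alb; apply/negP; rewrite -leNgt; apply: ub_le_sup => //.
    by exists (2 * Cq h); exact: (alpha_set_ubound hE c0_gt0 Q3_coer (Q0D Dx)).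
  have [M [MT QM]] : exists M : 'M[R]_2, M^T = M /\ Q2 W Q0 x M + b * (s * \det M) < 0.
    apply: contrapT => nM; apply: nb; split; first exact: lt_trans alb.
    by move=> M MT; rewrite leNgt; apply/negP => QM; apply: nM; exists M.
  have [B BM QB] : exists2 B, block22 B = M &
      Q3 W (Q0 x *m B *m (Q0 x)^T) < - (b * (s * \det M)).
    by apply/(Q2_lt c0_gt0 Q3_coer); rewrite -subr_lt0 opprK.
  have tP : [/\ 0 < (b, B).1, (b, B).1 < a & (block22 (b, B).2)^T = block22 (b, B).2].
    by split => //=; [exact: lt_trans alb | rewrite BM].
  exists (exist _ (b, B) tP) => //; split=> //=.
  by rewrite BM -ltrBrDr sub0r.
apply: bigcup_open => t _; apply: open_preimage_lt => // x Dx.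
by apply: continuousD; [exact: continuous_Q3_conj | exact: cst_continuous].
Qed.

Lemma block22B (B B' : 'M[R]_3) : block22 (B - B') = block22 B - block22 B'.
Proof. by apply/matrixP => i j; rewrite !mxE. Qed.

Lemma measurable_ext33 (A : R -> 'M[R]_2) i j :
  (forall k l, measurable_fun D (fun x => A x k l)) ->
  measurable_fun D (fun x => ext33 (A x) i j).
Proof.
move=> mA; case: (@split_ordP 2 1 i) => k ->; case: (@split_ordP 2 1 j) => l ->;
  (under eq_fun do rewrite ext33E); first [exact: mA | exact: measurable_cst].
Qed.

Let offblock (B : 'M[R]_3) := B - ext33 (block22 B).

Let offblockB B B' : offblock (B - B') = offblock B - offblock B'.
Proof.
rewrite /offblock block22B ext33B !opprB addrACA [RHS]addrACA.
by congr (_ + _); rewrite addrC.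
Qed.

Let sqn_offblock B : sqn (offblock B) <= 4 * sqn B.
Proof.
apply: le_trans (sqnD_le _ _) _; rewrite sqnN sqn_ext33.
by have := sqn_block22_le B; lra.
Qed.

(** The set of completions moves with [x]. Fixing the block to [A x] and letting only the other
    entries range over rational matrices gives countably many measurable functions with the same
    infimum: a near-optimal [B] is approximated by adding [offblock (P - B)], which leaves the block
    unchanged. *)
Lemma measurable_Q2 (A : R -> 'M[R]_2) :
  (forall i j, measurable_fun D (fun x => A x i j)) ->
  measurable_fun D (fun x => Q2 W Q0 x (A x)).
Proof.
move=> mA.
pose B_ (P : 'M[rat]_3) x := ext33 (A x) + offblock (map_mx ratr P).
have blockB P x : block22 (B_ P x) = A x.
  by rewrite /B_ block22D block22B !block22_ext33 subrr addr0.
pose F (P : 'M[rat]_3) x := Q3 W (Q0 x *m B_ P x *m (Q0 x)^T).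
apply: (@measurable_fun_countable_inf _ D _ F).
  move=> P; apply: measurable_Q3_conj => i j.
  under eq_fun do rewrite mxE.
  by apply: measurable_funD => //; exact: measurable_ext33.
move=> x a Dx; split=> [/(Q2_lt c0_gt0 Q3_coer)[B BA Ba]|[P FP]]; last first.
  by apply/(Q2_lt c0_gt0 Q3_coer); exists (B_ P x).
set v := Q3 W _ in Ba.
have v0 : 0 <= v by exact: (Q3_ge0 c0_gt0 Q3_coer).
have Cq0 : 0 <= Cq h.
  by do 4! apply: sumr_ge0 => ? _.
(* Young's inequality is balanced so that the factor [1 + e] adds at most [(a - v) / 2] to [v],
   while the density parameter below keeps the perturbation term under [(a - v) / 4]; the total
   stays below [a]. *)
pose e := (a - v) / (2 * (v + 1)).
have e0 : 0 < e by rewrite divr_gt0 ?subr_gt0// mulr_gt0// ltr_wpDl.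
pose K := (1 + e^-1) * (Cq h + 1) * 4.
have K0 : 0 < K.
  have e1 : 0 < 1 + e^-1 by rewrite ltr_wpDl// invr_gt0.
  have C1 : 0 < Cq h + 1 by rewrite ltr_wpDl.
  by rewrite /K; apply: mulr_gt0 => //; exact: mulr_gt0.
have d0 : 0 < (a - v) / 4 / K by rewrite !divr_gt0// subr_gt0.
have [P HP] := rat_mx_dense B d0.
exists P; rewrite /F.
have -> : B_ P x = B + offblock (map_mx ratr P - B).
  by rewrite offblockB [RHS]addrCA [RHS]addrC; congr (_ + _); rewrite /offblock subKr BA.
rewrite mulmxDr mulmxDl; apply: le_lt_trans (Q3D_le hE c0_gt0 Q3_coer _ _ e0) _.
have QH := Q3_le hE (Q0 x *m offblock (map_mx ratr P - B) *m (Q0 x)^T).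
rewrite (sqn_conj _ (Q0D Dx)) in QH.
have {}QH := le_trans QH (ler_wpM2l Cq0 (sqn_offblock _)).
rewrite -/v; set w := Q3 W _ in QH *.
have w1 : (1 + e^-1) * w <= (a - v) / 4.
  apply: (@le_trans _ _ (K * sqn (map_mx ratr P - B))).
    rewrite /K -!mulrA ler_wpM2l ?addr_ge0 ?invr_ge0// ?(ltW e0)//.
    by apply: le_trans QH _; rewrite ler_wpM2r ?lerDl// mulr_ge0// sqn_ge0.
  by rewrite mulrC -ler_pdivlMr.
have v1 : (1 + e) * v <= v + (a - v) / 2.
  rewrite mulrDl mul1r lerD2l; apply: (@le_trans _ _ (e * (v + 1))).
    by rewrite ler_wpM2l ?lerDl// ltW.
  by rewrite le_eqVlt; apply/orP; left; apply/eqP; rewrite /e; field; rewrite gt_eqF// ltr_wpDl.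
apply: le_lt_trans (lerD v1 w1) _.
by lra.
Qed.

End MeasurableQ2.

(** * Measurable selection of minimizers *)

Section Selection.
Context {R : realType}.
Variables (D : set R) (K Lip : R).
Hypothesis mD : measurable D.
Hypothesis K0 : 0 <= K.
Hypothesis Lip0 : 0 < Lip.

(** Precomposition with this retraction onto [[-K, K]] turns minimization over a box into
    minimization over the whole line, where rationals are dense, without changing the infimum or the
    Lipschitz constant. *)
Definition clamp (t : R) : R := Num.max (- K) (Num.min K t).

Lemma clamp_le t : - K <= clamp t <= K.
Proof.
by rewrite /clamp le_max lexx /= ge_max ge_min lexx/= andbT -subr_ge0 opprK addr_ge0.
Qed.

Lemma clamp_id t : - K <= t <= K -> clamp t = t.
Proof. by move=> /andP[lo hi]; rewrite /clamp min_r// max_r. Qed.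

Lemma clamp_idem t : clamp (clamp t) = clamp t.
Proof. exact: clamp_id (clamp_le t). Qed.

Lemma clamp_lip t s : `|clamp t - clamp s| <= `|t - s|.
Proof.
wlog ts : t s / s <= t.
  by move=> H; have [/H//|/ltW/H] := leP s t; rewrite distrC [leRHS]distrC.
rewrite [leRHS]ger0_norm ?subr_ge0// ler_norml; have := K0; move: ts.
rewrite /clamp; case: (leP K t) => Kt; case: (leP K s) => Ks;
  case: (leP (- K) K) => KK; case: (leP (- K) t) => KKt; case: (leP (- K) s) => KKs;
  move=> ts KK0; apply/andP; split; lra.
Qed.

Lemma inf_ltP (S : set R) a : S !=set0 -> has_lbound S ->
  inf S < a <-> exists2 z, S z & z < a.
Proof.
move=> S0 lS; split=> [Sa|[z Sz za]]; last by apply: le_lt_trans za; exact: ge_inf.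
apply: contrapT => nS; move: Sa; apply/negP; rewrite -leNgt.
apply: lb_le_inf => // z Sz; rewrite leNgt; apply/negP => za.
by apply: nS; exists z.
Qed.

Section Inf1.
Variable F : R -> R -> R.
Hypothesis F0 : forall x c, D x -> 0 <= F x c.
Hypothesis Flip : forall x c c', D x -> F x c' <= F x c + Lip * `|c' - c|.
Hypothesis mF : forall c, measurable_fun D (F^~ c).

Definition minval x : R := inf (range (F x)).

Lemma minval_le x c : D x -> minval x <= F x c.
Proof.
by move=> Dx; apply: ge_inf; [exists 0 => _ [z _ <-]; exact: F0 | exists c].
Qed.

Lemma minval_ltP x a : D x -> minval x < a <-> exists q : rat, F x (ratr q) < a.
Proof.
move=> Dx; split=> [|[q]]; last by apply: le_lt_trans; exact: minval_le.
move/inf_ltP => []; [by exists (F x 0), 0 | by exists 0 => _ [z _ <-]; exact: F0 |].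
move=> _ [c _ <-] Fa.
have e0 : 0 < (a - F x c) / Lip by rewrite divr_gt0// subr_gt0.
have /rat_in_itvoo[q] : c < c + (a - F x c) / Lip by rewrite ltrDl.
rewrite in_itv/= => /andP[cq qe]; exists q.
apply: le_lt_trans (Flip c _ Dx) _; rewrite gtr0_norm ?subr_gt0//.
by rewrite -ltrBrDl mulrC -ltr_pdivlMr// ltrBlDl.
Qed.

Lemma measurable_minval : measurable_fun D minval.
Proof.
apply: (measurable_fun_countable_inf (F := fun q : rat => F^~ (ratr q))).
  by move=> q; exact: mF.
exact: minval_ltP.
Qed.

Hypothesis Fclamp : forall x c, D x -> F x (clamp c) = F x c.

(* [u] is the limit of the infima [u_ n] of the rational [1 / n.+1]-minimizers,
   that is, the smallest minimizer; [K + 1] is a junk value above all of them. *)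
Lemma measurable_argmin : exists u : R -> R,
  [/\ measurable_fun D u, forall x, D x -> - K <= u x <= K &
      forall x c, D x -> F x (u x) <= F x c].
Proof.
pose w n (q : rat) x := if F x (clamp (ratr q)) < minval x + n.+1%:R^-1
  then clamp (ratr q) else K + 1.
pose u_ n x := inf (range (w n ^~ x)).
pose u x := sup (range (u_ ^~ x)).
have w_ge n q x : - K <= w n q x.
  rewrite /w; case: ifP => _; last by move: K0; lra.
  by have /andP[] := clamp_le (ratr q).
have lw n x : has_lbound (range (w n ^~ x)).
  by exists (- K) => _ [q _ <-].
have u_ge n x : - K <= u_ n x.
  by apply: lb_le_inf => [|_ [q _ <-] //]; exists (w n 0 x), 0.
have u_le_w n q x : u_ n x <= w n q x by apply: ge_inf => //; exists q.
have good n x : D x -> exists q : rat, F x (clamp (ratr q)) < minval x + n.+1%:R^-1.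
  move=> Dx; have [q] : exists q : rat, F x (ratr q) < minval x + n.+1%:R^-1.
    by apply/minval_ltP => //; rewrite ltrDl invr_gt0.
  by exists q; rewrite Fclamp.
have u_le n x : D x -> u_ n x <= K.
  move=> /(good n)[q Fq]; apply: le_trans (u_le_w n q x) _.
  by rewrite /w Fq; have /andP[] := clamp_le (ratr q).
(* A larger index tightens the tolerance, which can only replace a clamped rational by the larger
   junk value. *)
have u_mono x m n : (m <= n)%N -> u_ m x <= u_ n x.
  move=> mn; apply: lb_le_inf => [|_ [q _ <-]]; first by exists (w n 0 x), 0.
  apply: le_trans (u_le_w m q x) _; rewrite /w.
  case: ifPn => [_|]; last first.
    rewrite -leNgt => H; rewrite ifF//; apply/negbTE; rewrite -leNgt.
    by apply: le_trans H; rewrite lerD2l lef_pV2 ?posrE// ler_nat.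
  case: ifP => // _; have /andP[_] := clamp_le (ratr q).
  by move/le_trans; apply; rewrite lerDl.
have ubu x : D x -> has_ubound (range (u_ ^~ x)).
  by move=> Dx; exists K => _ [n _ <-]; exact: u_le.
have u_le_u n x : D x -> u_ n x <= u x.
  by move=> Dx; apply: ub_le_sup; [exact: ubu | exists n].
have mu_ n : measurable_fun D (u_ n).
  apply: (measurable_fun_countable_inf (F := w n)).
    move=> q; apply: measurable_fun_if => //.
    apply: measurable_fun_ltr; first exact: mF.
    by apply: measurable_funD => //; exact: measurable_minval.
  move=> x a Dx; rewrite inf_ltP//; last by exists (w n 0 x), 0.
  by split=> [[_ [q _ <-] ?]|[q ?]]; [exists q | exists (w n q x) => //; exists q].
have mu : measurable_fun D u.
  rewrite (_ : u = - (- u)); last by rewrite opprK.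
  apply: measurable_funN.
  apply: (measurable_fun_countable_inf (F := fun n => - u_ n)).
    by move=> n; exact: measurable_funN.
  move=> x a Dx; rewrite /= ltrNl; split=> [H|[n]].
    have [_ [n _ <-] Hn] := sup_gt (ex_intro _ _ (ex_intro2 _ _ 0%N I erefl)) H.
    by exists n; rewrite ltrNl.
  by move=> Hn; apply: lt_le_trans (u_le_u n x Dx); rewrite ltrNl; exact: Hn.
exists u; split => // [x Dx|x c Dx].
  apply/andP; split; first exact: le_trans (u_ge 0%N x) (u_le_u _ _ Dx).
  by apply: ge_sup => [|_ [n _ <-]]; [exists (u_ 0%N x), 0%N | exact: u_le].
apply: le_trans (minval_le c Dx).
apply/ler_addgt0Pr => e e0.
(* The bound by 1 keeps [u_ n x + d] at most [K + 1], so a [q] with [w n q x] below it cannot carry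
   the junk value; the other bound makes the Lipschitz error at most [e / 2]. *)
pose d := Num.min 1 (e / (2 * Lip)).
have d0 : 0 < d by rewrite lt_min ltr01 divr_gt0// mulr_gt0.
have dLip : Lip * d <= e / 2.
  rewrite mulrC -ler_pdivlMr// (le_trans (_ : d <= e / (2 * Lip)))//.
    by rewrite /d ge_min lexx orbT.
  by rewrite invfM mulrA.
have d1 : d <= 1 by rewrite /d ge_min lexx.
have [_ [n1 _ <-] Hn1] : exists2 z, range (u_ ^~ x) z & u x - d < z.
  by apply: sup_gt; [exists (u_ 0%N x), 0%N | rewrite ltrBlDr ltrDl].
have [n2 Hn2] : exists n : nat, n.+1%:R^-1 < e / 2.
  have [n _ H] := near_infty_natSinv_lt (PosNum (divr_gt0 e0 (ltr0n R 2))).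
  by exists n; exact: H (leqnn n).
pose n := maxn n1 n2.
have un : u x - d < u_ n x by apply: lt_le_trans Hn1 (u_mono _ _ _ (leq_maxl _ _)).
have en : n.+1%:R^-1 < e / 2.
  by apply: le_lt_trans Hn2; rewrite lef_pV2 ?posrE// ler_nat ltnS leq_maxr.
have [q Hq] : exists q, w n q x < u_ n x + d.
  have : u_ n x < u_ n x + d by rewrite ltrDl.
  by move/inf_ltP => []// => [|_ [q _ <-] ?]; [exists (w n 0 x), 0 | exists q].
have Fq : F x (clamp (ratr q)) < minval x + n.+1%:R^-1.
  apply: contraT => /negbTE nF; move: Hq; rewrite /w nF ltNge.
  by rewrite lerD// u_le.
have wq : w n q x = clamp (ratr q) by rewrite /w Fq.
apply: le_trans (Flip (clamp (ratr q)) _ Dx) _.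
have ud : `|u x - clamp (ratr q)| <= d.
  have H1 := u_le_w n q x; have H2 := u_le_u n x Dx; rewrite wq in Hq H1.
  by rewrite ler_norml; apply/andP; split; lra.
rewrite (splitr e) addrA; apply: lerD.
  by apply: le_trans (ltW Fq) _; rewrite lerD2l ltW.
by apply: le_trans dLip; rewrite ler_wpM2l// ltW.
Qed.

End Inf1.

Section Inf3.
Variable G : R -> R -> R -> R -> R.
Hypothesis G0 : forall x a b c, D x -> 0 <= G x a b c.
Hypothesis Glip : forall x a b c a' b' c', D x ->
  G x a' b' c' <= G x a b c + Lip * (`|a' - a| + `|b' - b| + `|c' - c|).
Hypothesis Gclamp : forall x a b c, D x ->
  G x (clamp a) (clamp b) (clamp c) = G x a b c.
Hypothesis mG : forall u v w, measurable_fun D u -> measurable_fun D v ->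
  measurable_fun D w -> measurable_fun D (fun x => G x (u x) (v x) (w x)).

Lemma inf_lip (f g : R -> R) d : (forall c, 0 <= f c) ->
  (forall c, f c <= g c + d) -> inf (range f) <= inf (range g) + d.
Proof.
move=> f0 fg; rewrite -lerBlDr; apply: lb_le_inf; first by exists (g 0), 0.
move=> _ [c _ <-]; rewrite lerBlDr; apply: le_trans (fg c).
by apply: ge_inf; [exists 0 => _ [z _ <-]|exists c].
Qed.

Lemma inf_range_ge0 (f : R -> R) : (forall c, 0 <= f c) -> 0 <= inf (range f).
Proof. by move=> f0; apply: lb_le_inf; [exists (f 0), 0 | move=> _ [z _ <-]]. Qed.

(* Lexicographic minimisation: the marginal infima over the last one and the
   last two variables are minimised first. *)
Lemma measurable_argmin3 : exists u v w : R -> R,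
  [/\ measurable_fun D u, measurable_fun D v, measurable_fun D w,
      forall x, D x -> [/\ - K <= u x <= K, - K <= v x <= K & - K <= w x <= K] &
      forall x a b c, D x -> G x (u x) (v x) (w x) <= G x a b c].
Proof.
have ca x a b c : D x -> G x (clamp a) b c = G x a b c.
  by move=> Dx; rewrite -[LHS]Gclamp// clamp_idem Gclamp.
have cb x a b c : D x -> G x a (clamp b) c = G x a b c.
  by move=> Dx; rewrite -[LHS]Gclamp// clamp_idem Gclamp.
have cc x a b c : D x -> G x a b (clamp c) = G x a b c.
  by move=> Dx; rewrite -[LHS]Gclamp// clamp_idem Gclamp.
pose G1 x a b := inf (range (G x a b)).
pose G2 x a := inf (range (G1 x a)).
have G1_ge0 x a b : D x -> 0 <= G1 x a b by move=> Dx; apply: inf_range_ge0 => c; exact: G0.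
have G2_ge0 x a : D x -> 0 <= G2 x a by move=> Dx; apply: inf_range_ge0 => b; exact: G1_ge0.
have lipc x a b c c' : D x -> G x a b c' <= G x a b c + Lip * `|c' - c|.
  by move=> Dx; have := Glip a b c a b c' Dx; rewrite !subrr normr0 !add0r.
have lipb x a b b' : D x -> G1 x a b' <= G1 x a b + Lip * `|b' - b|.
  move=> Dx; apply: inf_lip => c; first exact: G0.
  by have := Glip a b c a b' c Dx; rewrite !subrr normr0 add0r addr0.
have lipa x a a' : D x -> G2 x a' <= G2 x a + Lip * `|a' - a|.
  move=> Dx; apply: inf_lip => b; first exact: G1_ge0.
  apply: inf_lip => c; first exact: G0.
  by have := Glip a b c a' b c Dx; rewrite !subrr normr0 !addr0.
have mG1 u v : measurable_fun D u -> measurable_fun D v ->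
    measurable_fun D (fun x => G1 x (u x) (v x)).
  move=> mu mv; apply: (measurable_minval (F := fun x c => G x (u x) (v x) c)).
  - by move=> x c; exact: G0.
  - by move=> x c c'; exact: lipc.
  - by move=> c; apply: mG.
have mG2 a : measurable_fun D (G2^~ a).
  apply: (measurable_minval (F := fun x b => G1 x a b)).
  - by move=> x c; exact: G1_ge0.
  - by move=> x b b'; exact: lipb.
  - by move=> b; apply: mG1.
have [||||u [mu uK umin]] := @measurable_argmin G2.
- by move=> x a; exact: G2_ge0.
- by move=> x a a'; exact: lipa.
- exact: mG2.
- move=> x a Dx; suff E : G1 x (clamp a) = G1 x a by rewrite /G2 E.
  by apply/funext => b; rewrite /G1 (_ : G x (clamp a) b = G x a b)//; apply/funext => c; exact: ca.
have [||||v [mv vK vmin]] := @measurable_argmin (fun x b => G1 x (u x) b).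
- by move=> x a; exact: G1_ge0.
- by move=> x b b'; exact: lipb.
- by move=> b; apply: mG1.
- move=> x b Dx; rewrite /G1 (_ : G x (u x) (clamp b) = G x (u x) b)//.
  by apply/funext => c; exact: cb.
have [||||w [mw wK wmin]] := @measurable_argmin (fun x c => G x (u x) (v x) c).
- by move=> x c; exact: G0.
- by move=> x c c'; exact: lipc.
- by move=> c; apply: mG.
- by move=> x c; exact: cc.
exists u, v, w; split => // [x Dx|x a b c Dx].
  by split; [exact: uK | exact: vK | exact: wK].
have inf_le (f : R -> R) t : (forall c, 0 <= f c) -> inf (range f) <= f t.
  by move=> f0; apply: ge_inf; [exists 0 => _ [z _ <-]|exists t].
apply: (@le_trans _ _ (G1 x (u x) (v x))).
  by apply: lb_le_inf => [|_ [c' _ <-]]; [exists (G x (u x) (v x) 0), 0 | exact: wmin].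
apply: (@le_trans _ _ (G2 x (u x))).
  by apply: lb_le_inf => [|_ [b' _ <-]]; [exists (G1 x (u x) 0), 0 | exact: vmin].
apply: le_trans (umin x a Dx) _.
apply: (@le_trans _ _ (G1 x a b)); first by apply: inf_le => b'; exact: G1_ge0.
by apply: inf_le => c'; exact: G0.
Qed.

End Inf3.


End Selection.

(** * Pointwise estimates *)

Section Penalty.
Context {R : realType}.
Variables (ap am lo up : R).
Hypothesis aph : lo <= ap <= up.
Hypothesis amh : lo <= am <= up.
Hypothesis lo0 : 0 < lo.

Definition penalty (t : R) : R := ap * pos_part t + am * neg_part t.

Lemma penaltyE t : penalty t = if 0 <= t then ap * t else am * - t.
Proof.
rewrite /penalty /pos_part /neg_part; case: ifPn => t0.
  by rewrite max_l// max_r ?oppr_le0// mulr0 addr0.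
by rewrite -ltNge in t0; rewrite max_r ?(ltW t0)// max_l ?oppr_ge0 ?(ltW t0)// mulr0 add0r.
Qed.

Lemma penalty_ge t : lo * `|t| <= penalty t.
Proof.
move/andP: aph => [l1 _]; move/andP: amh => [l2 _]; rewrite penaltyE.
by case: (leP 0 t) => t0;
  [rewrite ger0_norm// ler_wpM2r | rewrite ltr0_norm// ler_wpM2r// oppr_ge0 ltW].
Qed.

Lemma penalty_le t : penalty t <= up * `|t|.
Proof.
move/andP: aph => [_ l1]; move/andP: amh => [_ l2]; rewrite penaltyE.
by case: (leP 0 t) => t0;
  [rewrite ger0_norm// ler_wpM2r | rewrite ltr0_norm// ler_wpM2r// oppr_ge0 ltW].
Qed.

Lemma penalty_ge0 t : 0 <= penalty t.
Proof. by apply: le_trans (penalty_ge t); rewrite mulr_ge0// ltW. Qed.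

(** Applied with the factor [(1 - s) ^+ 2] by which the determinant of a shrunk 2x2 matrix
    scales. *)
Lemma penaltyZ s t : 0 <= s -> penalty (s * t) = s * penalty t.
Proof.
move=> s0; rewrite /penalty /pos_part /neg_part -mulrN.
have maxZ y : Num.max (s * y) 0 = s * Num.max y 0 by rewrite maxr_pMr// mulr0.
by rewrite !maxZ; ring.
Qed.

Lemma penalty_lip t s : penalty t <= penalty s + up * `|t - s|.
Proof.
have sub a b : penalty (a + b) <= penalty a + penalty b.
  have posD (p q : R) : pos_part (p + q) <= pos_part p + pos_part q.
    by rewrite /pos_part ge_max addr_ge0 ?le_max ?lexx ?orbT// andbT lerD// le_max lexx.
  have negD (p q : R) : neg_part (p + q) <= neg_part p + neg_part q.
    by rewrite /neg_part opprD; exact: posD.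
  rewrite /penalty addrACA -!mulrDr; apply: lerD; rewrite ler_wpM2l//.
    by move/andP: aph => [/(lt_le_trans lo0)/ltW].
  by move/andP: amh => [/(lt_le_trans lo0)/ltW].
rewrite -{1}(subrK s t) addrC; apply: le_trans (sub _ _) _.
by rewrite lerD2l; exact: penalty_le.
Qed.

End Penalty.

(** * Eigenvalues of a symmetric 2x2 matrix and stability of its determinant *)

Section Eigen2.
Context {R : realType}.
Variables (A : 'M[R]_2) (k1 k2 : R).
Hypothesis eA : ordered_eigenvalues A k1 k2.

Lemma eigen_det : \det A = k1 * k2.
Proof.
have [cA _] := eA; have := char_poly_det A; rewrite cA sqrrN expr1n mul1r => <-.
by rewrite -horner_coef0 !hornerE; ring.
Qed.

Lemma eigen_trace : A 0 0 + A 1 1 = k1 + k2.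
Proof.
have [cA _] := eA; have := char_poly_trace A isT; rewrite cA /=.
rewrite /mxtrace !big_ord_recl big_ord0 addr0 (_ : lift ord0 ord0 = 1); last exact: val_inj.
move=> H; apply/oppr_inj; rewrite -H mulrBl !mulrBr -polyCM mulrC coefB coefB.
by rewrite !coefE /=; ring.
Qed.

Hypothesis AT : A^T = A.

Lemma eigen_sqn : sqn A = k1 ^+ 2 + k2 ^+ 2.
Proof.
have := eigen_trace; have := eigen_det; rewrite det_mx2 sqn2E (sym2E AT) => dA tA.
have -> : k1 ^+ 2 + k2 ^+ 2 = (k1 + k2) ^+ 2 - 2 * (k1 * k2) by ring.
by rewrite -tA -dA; ring.
Qed.

(** The determinant of [A + D] is [k1 * k2] plus the pairing [X] of the cofactors of [A] with [D]
    plus [\det D]. Cauchy-Schwarz with [sqn A <= 2 * k2 ^+ 2] gives [X ^+ 2 <= (k1 * k2) ^+ 2 / 8],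
    hence the factor 3/8, and [\det D] contributes at most 1/16; the sum 7/16 is below one half. *)
Lemma det_perturbation (D : 'M[R]_2) : D^T = D -> 16 * sqn D <= k1 ^+ 2 ->
  `|k1 * k2| <= 2 * `|\det (A + D)|.
Proof.
move=> DT D16; have [_ k12] := eA.
pose X := A 0 0 * D 1 1 + A 1 1 * D 0 0 - A 0 1 * D 0 1 - A 1 0 * D 1 0.
have dE : \det (A + D) = k1 * k2 + X + \det D.
  rewrite -eigen_det !det_mx2 !mxE (sym2E AT) (sym2E DT) /X (sym2E AT) (sym2E DT); ring.
have k1sq : k1 ^+ 2 <= `|k1 * k2|.
  by rewrite normrM -real_normK ?num_real// expr2 ler_wpM2l.
have hX : `|X| <= 3 / 8 * `|k1 * k2|.
  rewrite -ler_sqr ?nnegrE ?mulr_ge0// real_normK ?num_real// exprMn real_normK ?num_real//.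
  apply: (@le_trans _ _ (sqn A * sqn D)).
    rewrite /X (sym2E AT) (sym2E DT) !sqn2E (sym2E AT) (sym2E DT).
    set a := A 0 0; set b := A 0 1; set d := A 1 1.
    set p := D 0 0; set q := D 0 1; set r := D 1 1.
    rewrite -subr_ge0.
    (* Lagrange's identity, the exact remainder in Cauchy-Schwarz. *)
    suff -> : (a ^+ 2 + b ^+ 2 + b ^+ 2 + d ^+ 2) * (p ^+ 2 + q ^+ 2 + q ^+ 2 + r ^+ 2)
      - (a * r + d * p - b * q - b * q) ^+ 2 =
      (a * p - d * r) ^+ 2 + 2 * (a * q + b * r) ^+ 2 + 2 * (d * q + b * p) ^+ 2.
      by rewrite !addr_ge0 ?sqr_ge0// mulr_ge0// sqr_ge0.
    by ring.
  have k12s : k1 ^+ 2 <= k2 ^+ 2 by rewrite -ler_sqrt ?sqr_ge0// !sqrtr_sqr.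
  rewrite eigen_sqn; apply: (@le_trans _ _ (2 * k2 ^+ 2 * (k1 ^+ 2 / 16))).
    rewrite ler_pM ?addr_ge0 ?sqr_ge0 ?sqn_ge0//; first by lra.
    by rewrite ler_pdivlMr// mulrC.
  rewrite -subr_ge0 (_ : _ - _ = (k1 * k2) ^+ 2 / 64); last by field.
  by rewrite divr_ge0// sqr_ge0.
have hD : `|\det D| <= 1 / 16 * `|k1 * k2|.
  apply: le_trans (det_le_sqn D) _; move: D16 k1sq; move: (`|_|) => t; lra.
have H1 : `|k1 * k2| <= `|\det (A + D)| + `|X + \det D|.
  by rewrite -{1}[k1 * k2](addrK (X + \det D)) addrA -dE; exact: ler_normB.
have H2 := ler_normD X (\det D).
by have := normr_ge0 (k1 * k2); move: H1 H2 hX hD; clearbody X; lra.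
Qed.

End Eigen2.

(** * Bounds on the density and separation of its minimizers *)

Section Density.
Context {R : realType}.
Variables (W : 'M[R]_3 -> \bar R) (h : 'I_3 -> 'I_3 -> 'I_3 -> 'I_3 -> R) (c0 : R).
Hypothesis hE : forall B,
  Q3 W B = \sum_i \sum_j \sum_k \sum_l h i j k l * (B i j * B k l).
Hypothesis c0_gt0 : 0 < c0.
Hypothesis Q3_coer : forall (B : 'M[R]_3) i j, c0 * (B i j + B j i) ^+ 2 <= Q3 W B.
Variables (Q0 : R -> 'M[R]_3) (x : R).
Hypothesis Q0x : (Q0 x)^T *m Q0 x = 1%:M.

Let lo := c0 / 9.
Let up := 2 * Cq h.

#[local] Opaque Q2 Q3.

Lemma alpha_plus_bounds : lo <= alpha_plus W Q0 x <= up.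
Proof. by rewrite alpha_plusE; apply: (alpha_bounds hE) => //; left. Qed.

Lemma alpha_minus_bounds : lo <= alpha_minus W Q0 x <= up.
Proof. by rewrite alpha_minusE; apply: (alpha_bounds hE) => //; right. Qed.

Let lo0 : 0 < lo. Proof. by rewrite /lo divr_gt0. Qed.

Let lo_up : lo <= up.
Proof. by have /andP[] := alpha_plus_bounds; exact: le_trans. Qed.

Let up0 : 0 < up := lt_le_trans lo0 lo_up.

Definition density (A M : 'M[R]_2) : R := Q2 W Q0 x (M - A)
  + alpha_plus W Q0 x * pos_part (\det M) + alpha_minus W Q0 x * neg_part (\det M).

Let P := penalty (alpha_plus W Q0 x) (alpha_minus W Q0 x).

Lemma densityE A M : density A M = Q2 W Q0 x (M - A) + P (\det M).
Proof. by rewrite /density -addrA. Qed.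

Lemma density_ge (A M : 'M[R]_2) : A^T = A -> M^T = M ->
  lo * (sqn (M - A) + `|\det M|) <= density A M.
Proof.
move=> AT MT; rewrite densityE mulrDr; apply: lerD.
  by apply: (Q2_coer c0_gt0 Q3_coer Q0x); rewrite linearB /= AT MT.
by apply: penalty_ge; [exact: alpha_plus_bounds | exact: alpha_minus_bounds].
Qed.

Lemma Q2_le_up S : Q2 W Q0 x S <= up * sqn S.
Proof.
apply: le_trans (Q2_le hE c0_gt0 Q3_coer Q0x _) _; rewrite ler_wpM2r ?sqn_ge0//.
by rewrite /up -[leLHS]mul1r ler_wpM2r// ?ler1n// -(pmulr_rge0 _ (@ltr0n R 2)) ltW.
Qed.

Lemma density_le (A M : 'M[R]_2) :
  density A M <= up * (sqn (M - A) + `|\det M|).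
Proof.
rewrite densityE mulrDr; apply: lerD; first exact: Q2_le_up.
by apply: penalty_le; [exact: alpha_plus_bounds | exact: alpha_minus_bounds].
Qed.

Lemma density_ge0 (A M : 'M[R]_2) : 0 <= density A M.
Proof.
rewrite densityE addr_ge0//; first exact: (Q2_ge0 c0_gt0 Q3_coer).
by apply: (penalty_ge0 alpha_plus_bounds alpha_minus_bounds).
Qed.

Variables (A : 'M[R]_2) (k1 k2 : R).
Hypothesis AT : A^T = A.
Hypothesis eA : ordered_eigenvalues A k1 k2.

Lemma density_ge_eigen M : M^T = M -> lo / 16 * k1 ^+ 2 <= density A M.
Proof.
move=> MT; apply: le_trans (density_ge AT MT).
rewrite -mulrA ler_wpM2l ?(ltW lo0)//.
have s0 := sqn_ge0 (M - A); have d0 := normr_ge0 (\det M).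
have [D16|/ltW D16] := leP (16 * sqn (M - A)) (k1 ^+ 2); last first.
  by rewrite mulrC ler_pdivrMr//; move: D16; lra.
have DT : (M - A)^T = M - A by rewrite linearB /= AT MT.
have := det_perturbation eA AT DT D16; rewrite [A + _]addrC subrK.
have [_ k12] := eA.
have : k1 ^+ 2 <= `|k1 * k2|.
  by rewrite normrM -real_normK ?num_real// expr2 ler_wpM2l.
move: s0 d0; move: (sqn _) `|\det M| `|_ * _| => *; lra.
Qed.

Definition rank_one_competitor : 'M[R]_2 := A - k1%:M.

Lemma tr_competitor : rank_one_competitor^T = rank_one_competitor.
Proof. by rewrite /rank_one_competitor linearB /= AT tr_scalar_mx. Qed.

Lemma density_competitor_le : density A rank_one_competitor <= up * 2 * k1 ^+ 2.
Proof.
have D : rank_one_competitor - A = - k1%:M by rewrite /rank_one_competitor addrAC subrr add0r.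
have d0 : \det rank_one_competitor = 0.
  have := eigen_det eA; have := eigen_trace eA.
  rewrite !det_mx2 !mxE /= !mulr1n !mulr0n => tA dA.
  have -> : (A 0 0 - k1) * (A 1 1 - k1) - (A 0 1 - 0) * (A 1 0 - 0) =
    (A 0 0 * A 1 1 - A 0 1 * A 1 0) - k1 * (A 0 0 + A 1 1) + k1 ^+ 2 by ring.
  by rewrite dA tA; ring.
apply: le_trans (density_le _ _) _; rewrite D d0 normr0 addr0 sqnN sqn2E !mxE /=.
by rewrite !mulr1n !mulr0n -mulrA ler_pM2l//; lra.
Qed.

(* The competitor is [(1 - s) M] with [s] a small multiple of [|k1 / k2|]. *)
Lemma minimizer_separation M : M^T = M ->
  (forall N, N^T = N -> density A M <= density A N) ->
  (lo / (13 * up)) ^+ 2 * k1 ^+ 2 <= sqn (M - A).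
Proof.
move=> MT Mmin; rewrite leNgt; apply/negP => Dlt.
have [_ k12] := eA.
set D := M - A in Dlt.
have DT : D^T = D by rewrite /D linearB /= AT MT.
have dl : (lo / (13 * up)) ^+ 2 <= 16^-1.
  have d13 : lo / (13 * up) <= 13^-1.
    have up13 : 0 < 13 * up by exact: mulr_gt0.
    by rewrite ler_pdivrMr// mulKf.
  apply: (@le_trans _ _ (13^-1 ^+ 2)); last by lra.
  by rewrite ler_sqr ?nnegrE ?invr_ge0// divr_ge0// ltW// mulr_gt0.
have D16 : 16 * sqn D <= k1 ^+ 2.
  rewrite -ler_pdivlMl//; apply: le_trans (ltW Dlt) _.
  by rewrite ler_wpM2r ?sqr_ge0.
set u := `|k1| in k12; set r := `|k2| in k12.
have uE : k1 ^+ 2 = u ^+ 2 by rewrite real_normK ?num_real.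
have rE : k2 ^+ 2 = r ^+ 2 by rewrite real_normK ?num_real.
have u0 : 0 < u.
  rewrite normr_gt0; apply/eqP => k10; move: Dlt; rewrite k10 expr0n mulr0.
  by apply/negP; rewrite -leNgt sqn_ge0.
have r0 : 0 < r by exact: lt_le_trans u0 k12.
have MA : A + D = M by rewrite /D addrC subrK.
have hdet : u * r <= 2 * `|\det M|.
  by have := det_perturbation eA AT DT D16; rewrite normrM MA.
have ur2 : u ^+ 2 <= r ^+ 2 by rewrite ler_sqr// nnegrE ltW.
have sM : sqn M <= 5 * r ^+ 2.
  rewrite -MA; apply: le_trans (sqnD_le _ _) _.
  by rewrite (eigen_sqn eA AT) rE uE; have := sqr_ge0 r; move: D16 ur2; rewrite uE; lra.
(* The gain is linear in [s] and the cost of shrinking quadratic, so a small [eta] favours the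
   gain. *)
pose eta := lo / (40 * up).
have up40 : 0 < 40 * up by exact: mulr_gt0.
have eta0 : 0 < eta by exact: divr_gt0.
have eta1 : eta <= 1.
  rewrite ler_pdivrMr// mul1r; apply: le_trans lo_up _.
  by rewrite ler_peMl ?ler1n// ltW.
pose s := eta * u / r.
have s0 : 0 < s by rewrite divr_gt0// mulr_gt0.
have s1 : s <= 1 by rewrite ler_pdivrMr// mul1r -[leRHS]mul1r ler_pM// ltW.
have NT : ((1 - s) *: M)^T = (1 - s) *: M by rewrite linearZ /= MT.
have ND : (1 - s) *: M - A = D + (- s) *: M.
  by rewrite scalerBl scale1r scaleNr /D addrAC.
have := Mmin _ NT; rewrite !densityE ND detZ /P penaltyZ ?sqr_ge0// -/P -/D => H.
set p := P (\det M) in H.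
have p0 : 0 <= p by exact: (penalty_ge0 alpha_plus_bounds alpha_minus_bounds).
have p_ge : lo * (u * r) <= 2 * p.
  have := penalty_ge alpha_plus_bounds alpha_minus_bounds (\det M).
  rewrite -/P -/p => /(ler_wpM2l (ler0n R 2)); apply: le_trans.
  by rewrite [leRHS]mulrCA ler_wpM2l// ltW.
(* One of the two copies of [Q2 D] produced by the splitting inequality cancels against the density
   of [M], and [(1 - s) ^+ 2 <= 1 - s] leaves the gain [s * p]. *)
have sp : s * p <= Q2 W Q0 x D + 2 * (s ^+ 2 * (up * sqn M)).
  have := le_trans H (lerD (Q2D2_le hE c0_gt0 Q3_coer Q0 x D _) (lexx _)).
  have := Q2_le_up (- s *: M); rewrite sqnZ sqrrN mulrCA.
  have : (1 - s) ^+ 2 * p <= (1 - s) * p.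
    by rewrite ler_wpM2r// expr2 ler_piMr ?subr_ge0// gerBl ltW.
  move: (Q2 _ _ _ D) (Q2 _ _ _ _) => q1 q2; move: (_ ^+ 2 * p) => t.
  rewrite mulrBl mul1r; lra.
have Q2D_up : Q2 W Q0 x D < up * ((lo / (13 * up)) ^+ 2 * u ^+ 2).
  by apply: le_lt_trans (Q2_le_up D) _; rewrite ltr_pM2l// -uE.
have sp_ge : eta * lo * u ^+ 2 <= 2 * (s * p).
  have -> : eta * lo * u ^+ 2 = s * (lo * (u * r)).
    by rewrite /s; field; rewrite gt_eqF.
  by rewrite [leRHS]mulrCA ler_wpM2l// ltW.
have sM_le : s ^+ 2 * (up * sqn M) <= 5 * up * eta ^+ 2 * u ^+ 2.
  have -> : 5 * up * eta ^+ 2 * u ^+ 2 = s ^+ 2 * (up * (5 * r ^+ 2)).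
    by rewrite /s; field; rewrite gt_eqF.
  by rewrite !ler_wpM2l ?sqr_ge0// ltW.
(* In units of [q] the gain [s * p] is at least 1/80, while the cost is below 1/169 + 2/320; the
   constants 13 and 40 make the latter smaller. *)
pose q := lo ^+ 2 / up * u ^+ 2.
have q0 : 0 < q by rewrite mulr_gt0 ?divr_gt0 ?exprn_gt0.
have E1 : eta * lo * u ^+ 2 = q / 40 by rewrite /q /eta; field; rewrite gt_eqF.
have E2 : up * ((lo / (13 * up)) ^+ 2 * u ^+ 2) = q / 169.
  by rewrite /q; field; rewrite gt_eqF.
have E3 : 5 * up * eta ^+ 2 * u ^+ 2 = q / 320.
  by rewrite /q /eta; field; rewrite gt_eqF.
rewrite E1 in sp_ge; rewrite E2 in Q2D_up; rewrite E3 in sM_le.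
move: sp Q2D_up sp_ge sM_le q0; move: (Q2 _ _ _ _) (s * p) (s ^+ 2 * _).
by clearbody q; move=> t1 t2 t3; lra.
Qed.

End Density.

(** * Measurable pointwise minimizers *)

Section DensityBox.
Context {R : realType}.
Variables (W : 'M[R]_3 -> \bar R) (h : 'I_3 -> 'I_3 -> 'I_3 -> 'I_3 -> R) (c0 : R).
Hypothesis hE : forall B,
  Q3 W B = \sum_i \sum_j \sum_k \sum_l h i j k l * (B i j * B k l).
Hypothesis c0_gt0 : 0 < c0.
Hypothesis Q3_coer : forall (B : 'M[R]_3) i j, c0 * (B i j + B j i) ^+ 2 <= Q3 W B.
Variables (Q0 : R -> 'M[R]_3).

Let lo := c0 / 9.
Let up := 2 * Cq h.

#[local] Opaque Q2 Q3.

Let lo0 : 0 < lo. Proof. by rewrite /lo divr_gt0. Qed.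

Lemma sqn2_le (S : 'M[R]_2) t : 0 <= t -> (forall i j, `|S i j| <= t) -> sqn S <= 4 * t ^+ 2.
Proof.
move=> t0 St; have sq i j : S i j ^+ 2 <= t ^+ 2.
  by rewrite -real_normK ?num_real// ler_sqr ?nnegrE.
rewrite sqn2E; have := sq 0 0; have := sq 0 1; have := sq 1 0; have := sq 1 1.
by move: (S 0 0 ^+ 2) (S 0 1 ^+ 2) (S 1 0 ^+ 2) (S 1 1 ^+ 2) (t ^+ 2) => *; lra.
Qed.

Section AtPoint.
Variable x : R.
Hypothesis Q0x : (Q0 x)^T *m Q0 x = 1%:M.

Let lo_up : lo <= up.
Proof.
by have /andP[] := alpha_plus_bounds hE c0_gt0 Q3_coer Q0x; exact: le_trans.
Qed.

Let up0 : 0 < up := lt_le_trans lo0 lo_up.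

(** Young's inequality with weight [e = d] yields a Lipschitz bound: [d * Q2 (M - A)] is linear in
    [d], and so is [(1 + d^-1) * Q2 (M' - M)] up to a term in [d ^+ 2], since [Q2 (M' - M)] is
    quadratic in [d]. The condition [d <= 6 * K], satisfied by a sum of three differences of clamped
    entries, absorbs that term. *)
Lemma density_lip_box K d (A M M' : 'M[R]_2) : 0 <= K ->
  (forall i j, `|A i j| <= K) -> (forall i j, `|M i j| <= K) ->
  (forall i j, `|M' i j| <= K) -> (forall i j, `|M' i j - M i j| <= d) -> d <= 6 * K ->
  density W Q0 x A M' <= density W Q0 x A M + up * (16 * K ^+ 2 + 28 * K + 4) * d.
Proof.
move=> K0 AK MK MK' Md dK.
have : 0 <= d by apply: le_trans (Md 0 0).
rewrite le_eqVlt => /orP[/eqP d0|d0].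
  rewrite -d0 mulr0 addr0 (_ : M' = M)//; apply/matrixP => i j.
  by have := Md i j; rewrite -d0 normr_le0 subr_eq0 => /eqP.
have aP := alpha_plus_bounds hE c0_gt0 Q3_coer Q0x.
have aM := alpha_minus_bounds hE c0_gt0 Q3_coer Q0x.
have detd : `|\det M' - \det M| <= 4 * K * d.
  rewrite !det_mx2.
  have -> : M' 0 0 * M' 1 1 - M' 0 1 * M' 1 0 - (M 0 0 * M 1 1 - M 0 1 * M 1 0) =
    (M' 0 0 * (M' 1 1 - M 1 1) + (M' 0 0 - M 0 0) * M 1 1) -
    (M' 0 1 * (M' 1 0 - M 1 0) + (M' 0 1 - M 0 1) * M 1 0) by ring.
  have b1 i j k l : `|M' i j * (M' k l - M k l)| <= K * d by rewrite normrM ler_pM.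
  have b2 i j k l : `|(M' i j - M i j) * M k l| <= K * d by rewrite normrM mulrC ler_pM.
  apply: le_trans (ler_normB _ _) _.
  apply: le_trans (lerD (ler_normD _ _) (ler_normD _ _)) _.
  apply: le_trans (lerD (lerD (b1 _ _ _ _) (b2 _ _ _ _)) (lerD (b1 _ _ _ _) (b2 _ _ _ _))) _.
  by rewrite le_eqVlt; apply/orP; left; apply/eqP; ring.
have P1 : penalty (alpha_plus W Q0 x) (alpha_minus W Q0 x) (\det M') <=
    penalty (alpha_plus W Q0 x) (alpha_minus W Q0 x) (\det M) + up * (4 * K * d).
  apply: le_trans (penalty_lip aP aM lo0 _ (\det M)) _.
  by rewrite lerD2l ler_wpM2l// ltW.
have sM : sqn (M - A) <= 4 * (K + K) ^+ 2.
  apply: sqn2_le; first by rewrite addr_ge0.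
  by move=> i j; rewrite !mxE; apply: le_trans (ler_normB _ _) _; rewrite lerD.
have sD : sqn (M' - M) <= 4 * d ^+ 2.
  by apply: sqn2_le; [rewrite ltW | move=> i j; rewrite !mxE].
have Q2up S : Q2 W Q0 x S <= up * sqn S.
  exact: (Q2_le_up hE c0_gt0 Q3_coer Q0x).
have q1 := le_trans (Q2up (M - A)) (ler_wpM2l (ltW up0) sM).
have q2 := le_trans (Q2up (M' - M)) (ler_wpM2l (ltW up0) sD).
have Q1 : Q2 W Q0 x (M' - A) <= Q2 W Q0 x (M - A) + up * (16 * K ^+ 2 + 24 * K + 4) * d.
  have -> : M' - A = (M - A) + (M' - M) by rewrite [RHS]addrC addrA subrK.
  apply: le_trans (Q2D_le hE c0_gt0 Q3_coer Q0 x _ _ d0) _.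
  rewrite mulrDl mul1r -addrA lerD2l.
  have e1 : d * Q2 W Q0 x (M - A) <= d * (up * (4 * (K + K) ^+ 2)) by rewrite ler_wpM2l// ltW.
  have e2 : (1 + d^-1) * Q2 W Q0 x (M' - M) <= (1 + d^-1) * (up * (4 * d ^+ 2)).
    by rewrite ler_wpM2l// addr_ge0// invr_ge0 ltW.
  apply: le_trans (lerD e1 e2) _.
  have -> : (1 + d^-1) * (up * (4 * d ^+ 2)) = up * d * (4 * d + 4).
    by field; rewrite gt_eqF.
  rewrite -subr_ge0 (_ : _ - _ = up * d * (4 * (6 * K - d))); last by ring.
  by apply: mulr_ge0; [apply: mulr_ge0; exact: ltW | rewrite mulr_ge0// subr_ge0].
rewrite !densityE; apply: le_trans (lerD Q1 P1) _.
by rewrite le_eqVlt; apply/orP; left; apply/eqP; ring.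
Qed.

(** The competitor [A] costs at most [4 * up * K ^+ 2]. An entry of [M] beyond the stated size puts
    [M] at distance at least [2 * K * up / lo] from [A], at a cost of at least
    [4 * K ^+ 2 * up ^+ 2 / lo], which is no smaller because [lo <= up]. *)
Lemma density_outside_box K (A M : 'M[R]_2) i j : 0 <= K ->
  (forall i j, `|A i j| <= K) -> A^T = A -> M^T = M ->
  K * (1 + 2 * up / lo) < `|M i j| -> density W Q0 x A A <= density W Q0 x A M.
Proof.
move=> K0 AK AT MT Mij.
apply: le_trans (density_le hE c0_gt0 Q3_coer Q0x _ _) _.
rewrite subrr -[X in sqn X](scale0r 0) sqnZ expr0n mul0r add0r.
apply: (@le_trans _ _ (up * (4 * K ^+ 2))).
  by rewrite ler_wpM2l ?(ltW up0)//; apply: le_trans (det_le_sqn A) _; exact: sqn2_le.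
apply: le_trans (density_ge hE c0_gt0 Q3_coer Q0x AT MT).
apply: (@le_trans _ _ (lo * (K * (2 * up / lo)) ^+ 2)).
  rewrite -subr_ge0 (_ : _ - _ = 4 * K ^+ 2 * up / lo * (up - lo)); last first.
    by field; rewrite gt_eqF.
  by rewrite mulr_ge0 ?subr_ge0// divr_ge0 ?(ltW lo0)// mulr_ge0 ?(ltW up0)// mulr_ge0// sqr_ge0.
rewrite ler_wpM2l ?(ltW lo0)//; apply: (@le_trans _ _ (sqn (M - A))); last by rewrite lerDl.
apply: le_trans (sqr_entry_le_sqn _ i j).
rewrite -[leRHS]real_normK ?num_real// ler_sqr ?nnegrE ?normr_ge0//; last first.
  by rewrite mulr_ge0// divr_ge0 ?(ltW lo0)// mulr_ge0// ltW.
rewrite !mxE; apply: le_trans (lerB_dist _ _).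
by move: Mij (AK i j); rewrite mulrDr mulr1; lra.
Qed.

End AtPoint.

Variable D : set R.
Hypothesis oD : open D.
Hypothesis D0 : D !=set0.
Hypothesis Q0D : forall x, D x -> (Q0 x)^T *m Q0 x = 1%:M.
Hypothesis cQ0 : forall x i j, D x -> {for x, continuous (fun y => Q0 y i j)}.

Lemma measurable_density (A M : R -> 'M[R]_2) :
  (forall i j, measurable_fun D (fun x => A x i j)) ->
  (forall i j, measurable_fun D (fun x => M x i j)) ->
  measurable_fun D (fun x => density W Q0 x (A x) (M x)).
Proof.
move=> mA mM; have mdet : measurable_fun D (fun x => \det (M x)).
  under eq_fun do rewrite det_mx2.
  by apply: measurable_funB; exact: measurable_funM.
apply: measurable_funD; first apply: measurable_funD.
- apply: (measurable_Q2 hE c0_gt0 Q3_coer oD Q0D cQ0) => i j.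
  by under eq_fun do rewrite !mxE; exact: measurable_funB.
- apply: measurable_funM; last by apply: measurable_maxr => //; exact: measurable_cst.
  rewrite (_ : alpha_plus W Q0 = fun x => sup (alpha_set W Q0 x 1)); last first.
    by apply/funext => x; exact: alpha_plusE.
  by apply: (measurable_alpha hE c0_gt0 Q3_coer oD Q0D cQ0); left.
- apply: measurable_funM.
    rewrite (_ : alpha_minus W Q0 = fun x => sup (alpha_set W Q0 x (-1))); last first.
      by apply/funext => x; exact: alpha_minusE.
    by apply: (measurable_alpha hE c0_gt0 Q3_coer oD Q0D cQ0); right.
  by apply: measurable_maxr; [exact: measurable_funN | exact: measurable_cst].
Qed.

Definition symmx (a b c : R) : 'M[R]_2 := \matrix_(i, j) nth 0 [:: a; b; c] (i + j).

Lemma tr_symmx a b c : (symmx a b c)^T = symmx a b c.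
Proof. by apply/matrixP => i j; rewrite !mxE addnC. Qed.

Lemma symmxE (M : 'M[R]_2) : M^T = M -> M = symmx (M 0 0) (M 0 1) (M 1 1).
Proof.
move=> MT; apply/matrixP => i j; rewrite mxE.
have e (k : 'I_2) : k = 0 \/ k = 1.
  by case: k => [[|[|//]] k2]; [left | right]; exact: val_inj.
by case: (e i) => ->; case: (e j) => -> //=; exact: sym2E.
Qed.

Lemma symmx_entry (p : R -> Prop) a b c i j : p a -> p b -> p c -> p (symmx a b c i j).
Proof.
move=> pa pb pc; rewrite mxE.
by case: i => [[|[|//]] ?]; case: j => [[|[|//]] ?].
Qed.

(** Symmetric matrices are three real parameters, clamped to a box outside which [A x] itself is at
    least as good; minimality inside the box is therefore global. *)
Lemma measurable_density_argmin (A : R -> 'M[R]_2) K : 0 <= K ->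
  (forall i j, measurable_fun D (fun x => A x i j)) ->
  (forall x, D x -> (A x)^T = A x) ->
  (forall x i j, D x -> `|A x i j| <= K) ->
  exists M : R -> 'M[R]_2,
    [/\ forall x, (M x)^T = M x,
        forall i j, measurable_fun D (fun x => M x i j),
        exists K' : R, forall x i j, D x -> `|M x i j| <= K' &
        forall x N, D x -> N^T = N -> density W Q0 x (A x) (M x) <= density W Q0 x (A x) N].
Proof.
move=> K0 mA AT AK.
have [x0 Dx0] := D0.
have lo_up : lo <= up.
  by have /andP[] := alpha_plus_bounds hE c0_gt0 Q3_coer (Q0D Dx0); exact: le_trans.
have up0 := lt_le_trans lo0 lo_up.
pose K' := K * (1 + 2 * up / lo).
have KK' : K <= K'.
  by rewrite /K' ler_peMr// lerDl divr_ge0 ?(ltW lo0)// mulr_ge0// ltW.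
have K'0 : 0 <= K' := le_trans K0 KK'.
pose cl := clamp K'.
have clK t : `|cl t| <= K' by rewrite ler_norml clamp_le.
have clS a b c i j : `|symmx (cl a) (cl b) (cl c) i j| <= K'.
  by apply: (symmx_entry (p := fun t => `|t| <= K')).
pose G x a b c := density W Q0 x (A x) (symmx (cl a) (cl b) (cl c)).
pose Lip := up * (16 * K' ^+ 2 + 28 * K' + 4).
have Lip0 : 0 < Lip.
  by rewrite mulr_gt0// ltr_wpDl// addr_ge0// mulr_ge0// sqr_ge0.
have [||||u [v [w [mu mv mw uvwK uvwmin]]]] := @measurable_argmin3 R D K' Lip
  (open_measurable oD) K'0 Lip0 G.
- by move=> x a b c Dx; exact: (density_ge0 hE c0_gt0 Q3_coer (Q0D Dx)).
- move=> x a b c a' b' c' Dx.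
  pose d := `|cl a' - cl a| + `|cl b' - cl b| + `|cl c' - cl c|.
  have cl2 t s : `|cl t - cl s| <= 2 * K'.
    by apply: le_trans (ler_normB _ _) _; rewrite mulr_natl mulr2n lerD.
  have dK : d <= 6 * K'.
    by rewrite /d; have := cl2 a' a; have := cl2 b' b; have := cl2 c' c; lra.
  apply: le_trans (density_lip_box (Q0D Dx) (M := symmx (cl a) (cl b) (cl c)) (d := d)
    K'0 _ _ _ _ dK) _ => //.
  + by move=> i j; apply: le_trans (AK _ _ _ Dx) KK'.
  + move=> i j; rewrite !mxE /d.
    have := normr_ge0 (cl a' - cl a); have := normr_ge0 (cl b' - cl b).
    have := normr_ge0 (cl c' - cl c).
    by case: i => [[|[|//]] ?]; case: j => [[|[|//]] ?] /=; lra.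
  rewrite lerD2l ler_wpM2l ?(ltW Lip0)// /d.
  by rewrite !lerD ?clamp_lip.
- by move=> x a b c Dx; rewrite /G /cl !clamp_idem.
- move=> u v w mu mv mw; apply: measurable_density => // i j.
  have mcl f : measurable_fun D f -> measurable_fun D (fun x => cl (f x)).
    move=> mf; apply: measurable_maxr; first exact: measurable_cst.
    by apply: measurable_minr => //; exact: measurable_cst.
  under eq_fun do rewrite mxE.
  by case: i => [[|[|//]] ?]; case: j => [[|[|//]] ?] /=; exact: mcl.
exists (fun x => symmx (u x) (v x) (w x)); split.
- by move=> x; exact: tr_symmx.
- move=> i j; under eq_fun do rewrite mxE.
  by case: i => [[|[|//]] ?]; case: j => [[|[|//]] ?] /=.
- exists K' => x i j Dx; have [uK vK wK] := uvwK x Dx.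
  by apply: (symmx_entry (p := fun t => `|t| <= K')); rewrite ler_norml.
move=> x N Dx NT; have [uK vK wK] := uvwK x Dx.
have box (S : 'M[R]_2) : S^T = S -> (forall i j, `|S i j| <= K') ->
    density W Q0 x (A x) (symmx (u x) (v x) (w x)) <= density W Q0 x (A x) S.
  move=> ST SK; have := uvwmin x (S 0 0) (S 0 1) (S 1 1) Dx.
  have cS i j : clamp K' (S i j) = S i j by apply: clamp_id; rewrite -ler_norml.
  by rewrite /G /cl !cS (clamp_id uK) (clamp_id vK) (clamp_id wK) -symmxE.
have [NK|] := pselect (forall i j, `|N i j| <= K'); first exact: box.
move=> /existsNP[i] /existsNP[j] /negP; rewrite -ltNge => Nij.
apply: le_trans (density_outside_box (Q0D Dx) K0 _ (AT _ Dx) NT Nij).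
  by apply: box; [exact: AT | move=> k l; apply: le_trans (AK _ _ _ Dx) KK'].
by move=> k l; exact: AK.
Qed.

End DensityBox.

(** * The integral functional *)

Section Integral.
Context {R : realType}.
Local Notation mu := (@lebesgue_measure R).

Lemma Rintegral_eq0_ae (D : set R) (f : R -> R) : measurable D ->
  mu.-integrable D (EFin \o f) -> (forall x, D x -> 0 <= f x) ->
  \int[mu]_(x in D) f x = 0 -> {ae mu, forall x, D x -> f x = 0}.
Proof.
move=> mD intf f0 If.
have If' : (\int[mu]_(x in D) (EFin \o f) x)%E = 0%E.
  by rewrite -[LHS]fineK ?integrable_fin_num//; congr (_%:E).
have : (\int[mu]_(x in D) `|(EFin \o f) x|)%E = 0%E.
  rewrite -[RHS]If'; apply: eq_integral => x; rewrite inE => Dx.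
  by rewrite /= ger0_norm// f0.
move/ae_eq_integral_abs => /(_ mD (measurable_int _ intf)).
by apply: filterS => x H /H [].
Qed.

(** A nonzero value persists on a ball, which has positive measure and so cannot lie in the
    exceptional null set. *)
Lemma ae_eq0_continuous (D : set R) (f : R -> R) : open D ->
  (forall x, D x -> {for x, continuous f}) ->
  {ae mu, forall x, D x -> f x = 0} -> forall x, D x -> f x = 0.
Proof.
move=> oD cf [N [mN N0 HN]] x Dx; apply/eqP; apply: contraT => fx0.
have nf : \forall y \near x, f y != 0.
  have /cvgrPdist_lt/(_ `|f x|) := cf x Dx; rewrite normr_gt0 => /(_ fx0).
  apply: filterS => y; apply: contraTneq => ->.
  by rewrite subr0 ltxx.
have nD : \forall y \near x, D y by exact: open_nbhs_nbhs.
have /nbhs_ballP[r /= r0 rN] : \forall y \near x, N y.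
  near=> y; apply: HN => /= H.
  have Dy : D y by near: y.
  have : f y != 0 by near: y.
  by rewrite H// eqxx.
have : (mu (ball x r) <= mu N)%E.
  by apply: le_measure => //; rewrite inE//; exact: measurable_ball.
rewrite N0 lebesgue_measure_ball ?(ltW r0)// lee_fin.
by rewrite leNgt pmulrn_lgt0// r0.
Unshelve. all: by end_near. Qed.

End Integral.

Section SmoothOn.
Context {R : realType}.

Lemma smooth_on_continuous (a b : R) (f : R -> R) : smooth_on a b f ->
  {within `[a, b], continuous f}.
Proof.
move=> [g [gf cg]]; have [cg0 _] := cg 0%N.
by apply: subspace_eq_continuous cg0 => x; rewrite inE => /gf.
Qed.

Lemma within_continuous_bounded (a b : R) (f : R -> R) : a <= b ->
  {within `[a, b], continuous f} ->
  exists2 K, 0 <= K & forall x, x \in `[a, b] -> `|f x| <= K.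
Proof.
move=> ab cf; have [c cab cmax] := EVT_max ab (within_continuousM cf cf).
exists `|f c| => // x /cmax; rewrite -!expr2.
by rewrite -(ler_sqr (x := `|f x|)) ?nnegrE// !real_normK ?num_real.
Qed.

Lemma within_continuous_eq0 (L : R) (f : R -> R) : 0 < L ->
  {within `[0, L], continuous f} -> (forall x, x \in `]0, L[ -> f x = 0) ->
  forall x, x \in `[0, L] -> f x = 0.
Proof.
move=> L0 /(continuous_within_itvP _ L0)[_ f0 fL] f00 x; rewrite in_itv/= => /andP[].
rewrite le_eqVlt => /orP[/eqP <- _|x0].
  apply/esym/(cvg_unique _ _ f0) => //.
  apply: cvg_near_cst; near=> y; apply: f00; rewrite in_itv/=.
  by apply/andP; split; near: y; [exact: nbhs_right_gt | exact: nbhs_right_lt].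
rewrite le_eqVlt => /orP[/eqP ->|xL]; last by apply: f00; rewrite in_itv/= x0.
apply/esym/(cvg_unique _ _ fL) => //.
apply: cvg_near_cst; near=> y; apply: f00; rewrite in_itv/=.
by apply/andP; split; near: y; [exact: nbhs_left_gt | exact: nbhs_left_lt].
Unshelve. all: by end_near. Qed.

End SmoothOn.

Section Functional.
Context {R : realType}.
Local Notation mu := (@lebesgue_measure R).
Variables (W : 'M[R]_3 -> \bar R) (h : 'I_3 -> 'I_3 -> 'I_3 -> 'I_3 -> R) (c0 : R).
Hypothesis hE : forall B,
  Q3 W B = \sum_i \sum_j \sum_k \sum_l h i j k l * (B i j * B k l).
Hypothesis c0_gt0 : 0 < c0.
Hypothesis Q3_coer : forall (B : 'M[R]_3) i j, c0 * (B i j + B j i) ^+ 2 <= Q3 W B.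
Variables (Q0 : R -> 'M[R]_3) (L : R) (A : R -> 'M[R]_2) (K : R).
Hypothesis L0 : 0 < L.
Let D : set R := `]0, L[.
Hypothesis Q0D : forall x, D x -> (Q0 x)^T *m Q0 x = 1%:M.
Hypothesis cQ0 : forall x i j, D x -> {for x, continuous (fun y => Q0 y i j)}.
Hypothesis K0 : 0 <= K.
Hypothesis mA : forall i j, measurable_fun D (fun x => A x i j).
Hypothesis AT : forall x, D x -> (A x)^T = A x.
Hypothesis AK : forall x i j, D x -> `|A x i j| <= K.

Let lo := c0 / 9.
Let up := 2 * Cq h.

#[local] Opaque Q2 Q3 alpha_plus alpha_minus.

Let oD : open D. Proof. exact: interval_open. Qed.
Let mD : measurable D. Proof. exact: open_measurable. Qed.
Let D0 : D !=set0.
Proof. by exists (L / 2); rewrite /D /= in_itv/=; have := L0 => L0'; apply/andP; split; lra. Qed.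

Let muD : (mu D < +oo)%E.
Proof.
by rewrite lebesgue_measure_itv/=; case: ifP => // _; rewrite oppr0 ltry.
Qed.

Lemma integrable_bounded (f : R -> R) k : measurable_fun D f ->
  (forall x, D x -> `|f x| <= k) -> mu.-integrable D (EFin \o f).
Proof.
move=> mf fk; apply: measurable_bounded_integrable => //.
exists k; split; first exact: num_real.
by move=> y ky x Dx; apply: le_trans (fk x Dx) (ltW ky).
Qed.

Lemma L2sym_bounded (M : R -> 'M[R]_2) k : (forall x, (M x)^T = M x) ->
  (forall i j, measurable_fun D (fun x => M x i j)) ->
  (forall x i j, D x -> `|M x i j| <= k) -> L2sym L M.
Proof.
move=> MT mM Mk; split=> // i j; split; first exact: mM.
apply: (integrable_bounded (f := fun x => M x i j ^+ 2) (k := k ^+ 2)).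
  exact: measurable_funX.
move=> x Dx; rewrite normrX lerXn2r ?nnegrE//; last exact: Mk.
by apply: le_trans (Mk x i j Dx).
Qed.

Lemma integrable_density M : L2sym L M ->
  mu.-integrable D (EFin \o (fun x => density W Q0 x (A x) (M x))).
Proof.
move=> [MT ML2].
have mM i j : measurable_fun D (fun x => M x i j) by have [] := ML2 i j.
have isq : mu.-integrable D (fun x => (sqn (M x))%:E).
  have -> : (fun x => (sqn (M x))%:E) = (fun x => \sum_i \sum_j (M x i j ^+ 2)%:E)%E.
    by apply/funext => x; rewrite /sqn -sumEFin; apply: eq_bigr => i _; rewrite -sumEFin.
  apply: integrable_sum => // i _; apply: integrable_sum => // j _.
  by have [] := ML2 i j.
(* From [sqn (M - A) <= 2 * sqn M + 2 * sqn A], [sqn A <= 4 * K ^+ 2] and [|\det M| <= sqn M]. *)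
have bnd : mu.-integrable D (fun x => (up * 3)%:E * (sqn (M x))%:E + (up * (8 * K ^+ 2))%:E)%E.
  apply: integrableD => //; first exact: integrableZl.
  exact: (integrable_bounded (f := cst (up * (8 * K ^+ 2))) (k := `|up * (8 * K ^+ 2)|)).
apply: le_integrable bnd => //.
  by apply/measurable_EFinP; apply: (measurable_density hE c0_gt0 Q3_coer oD Q0D cQ0).
move=> x Dx; rewrite /= lee_fin ger0_norm; last exact: (density_ge0 hE c0_gt0 Q3_coer (Q0D Dx)).
apply: le_trans (ler_norm _); apply: le_trans (density_le hE c0_gt0 Q3_coer (Q0D Dx) _ _) _.
have up0 : 0 <= up.
  have /andP[l1 l2] := alpha_plus_bounds hE c0_gt0 Q3_coer (Q0D Dx).
  by apply: le_trans (le_trans l1 l2); rewrite divr_ge0// ltW.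
have -> : up * 3 * sqn (M x) + up * (8 * K ^+ 2) = up * (3 * sqn (M x) + 8 * K ^+ 2) by ring.
rewrite ler_wpM2l//; have := sqnD_le (M x) (- A x); rewrite sqnN; have := det_le_sqn (M x).
have := sqn2_le K0 (fun i j => AK i j Dx).
by move: (sqn (A x)) (sqn (M x)) (sqn _) `|_| => a b c d; lra.
Qed.

Lemma JE M : J L W A Q0 M = 12^-1 * L^-1 * \int[mu]_(x in D) density W Q0 x (A x) (M x).
Proof. by []. Qed.

Lemma is_minimizer_pointwise M : L2sym L M ->
  (forall x N, D x -> N^T = N -> density W Q0 x (A x) (M x) <= density W Q0 x (A x) N) ->
  is_minimizer L (J L W A Q0) M.
Proof.
move=> LM Mmin; split=> // N LN; rewrite !JE ler_wpM2l//.
  by rewrite mulr_ge0// invr_ge0 ltW.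
apply: le_Rintegral => //; [exact: integrable_density | exact: integrable_density |].
by move=> x Dx; apply: Mmin => //; case: LN => NT _; exact: NT.
Qed.

Lemma exists_pointwise_minimizer : exists2 M, L2sym L M & forall x N, D x -> N^T = N ->
  density W Q0 x (A x) (M x) <= density W Q0 x (A x) N.
Proof.
have [M [MT mM [k Mk] Mmin]] :=
  measurable_density_argmin hE c0_gt0 Q3_coer oD D0 Q0D cQ0 K0 mA AT AK.
by exists M => //; exact: L2sym_bounded Mk.
Qed.

(** The density of [N] exceeds that of the pointwise minimizer [M], with difference of integral
    zero, so both agree almost everywhere. Comparing through [M] yields a single null set for all
    competitors [S]. *)
Lemma minimizer_ae M N : L2sym L M ->
  (forall x S, D x -> S^T = S -> density W Q0 x (A x) (M x) <= density W Q0 x (A x) S) ->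
  is_minimizer L (J L W A Q0) N ->
  {ae mu, forall x, D x -> forall S, S^T = S ->
    density W Q0 x (A x) (N x) <= density W Q0 x (A x) S}.
Proof.
move=> LM Mmin [LN Nmin].
have iM := integrable_density LM; have iN := integrable_density LN.
have MN x : D x -> density W Q0 x (A x) (M x) <= density W Q0 x (A x) (N x).
  by move=> Dx; apply: Mmin => //; case: LN => NT _; exact: NT.
have Idiff : \int[mu]_(x in D)
    (density W Q0 x (A x) (N x) - density W Q0 x (A x) (M x)) = 0.
  apply/eqP; rewrite eq_le; apply/andP; split; last first.
    by apply: Rintegral_ge0 => x Dx; rewrite subr_ge0 MN.
  rewrite RintegralB// subr_le0.
  have := Nmin _ LM; rewrite !JE ler_pM2l//.
  by rewrite mulr_gt0// invr_gt0.
have : {ae mu, forall x, D x ->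
    density W Q0 x (A x) (N x) - density W Q0 x (A x) (M x) = 0}.
  apply: Rintegral_eq0_ae => //; last by move=> x Dx; rewrite subr_ge0 MN.
  have iB := @integrableB _ _ _ mu D mD _ _ iN iM.
  by apply: (@eq_integrable _ _ _ mu D mD _ _ _ iB).
move=> [Z [mZ Z0 HZ]]; exists Z; split=> // x nx; apply: HZ => /= H; apply: nx.
move=> Dx S ST; have /eqP := H Dx; rewrite subr_eq0 => /eqP ->.
exact: Mmin.
Qed.

Variables k1 k2 : R -> R.
Hypothesis eA : forall x, D x -> ordered_eigenvalues (A x) (k1 x) (k2 x).

(** When the eigenvalues are opposite, the ordering leaves the sign of [k1] free, and only its
    square is a function of [A]. The formula rests on [(|k1 + k2| - |k1 - k2|) ^+ 2 = 4 * k1 ^+ 2],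
    valid for [|k1| <= |k2|]. *)
Lemma measurable_smallest_eigenvalue : measurable_fun D (fun x => k1 x ^+ 2).
Proof.
pose t x := A x 0 0 + A x 1 1.
pose f x := 4^-1 * (`|t x| - Num.sqrt (t x ^+ 2 - 4 * \det (A x))) ^+ 2.
apply: (@eq_measurable_fun _ _ _ _ D f).
  move=> x; rewrite inE => Dx; have [_ k12] := eA Dx.
  rewrite /f /t (eigen_trace (eA Dx)) (eigen_det (eA Dx)).
  have -> : (k1 x + k2 x) ^+ 2 - 4 * (k1 x * k2 x) = (k1 x - k2 x) ^+ 2 by ring.
  rewrite sqrtr_sqr sqrrB !real_normK ?num_real// -normrM.
  rewrite (_ : (k1 x + k2 x) * _ = k1 x ^+ 2 - k2 x ^+ 2) 1?distrC; last by ring.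
  rewrite ger0_norm; first by field.
  by rewrite subr_ge0 -[leLHS]real_normK ?num_real// -[leRHS]real_normK ?num_real// ler_sqr ?nnegrE.
have mt : measurable_fun D t by exact: measurable_funD.
have mdet : measurable_fun D (fun x => \det (A x)).
  under eq_fun do rewrite det_mx2.
  by apply: measurable_funB; exact: measurable_funM.
apply: measurable_funM => //; apply: measurable_funX; apply: measurable_funB.
  exact: measurableT_comp.
apply: (measurableT_comp (f := @Num.sqrt R)).
  by apply: continuous_measurable_fun; exact: sqrt_continuous.
apply: measurable_funB; first exact: measurable_funX.
exact: measurable_funM.
Qed.

Lemma integrable_smallest_eigenvalue : mu.-integrable D (EFin \o (fun x => k1 x ^+ 2)).
Proof.
apply: (integrable_bounded (k := 4 * K ^+ 2)); first exact: measurable_smallest_eigenvalue.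
move=> x Dx; rewrite ger0_norm ?sqr_ge0//.
apply: le_trans (sqn2_le K0 (fun i j => AK i j Dx)).
by rewrite (eigen_sqn (eA Dx) (AT Dx)) lerDl sqr_ge0.
Qed.

Lemma minimum_bounds M : L2sym L M ->
  (forall x N, D x -> N^T = N -> density W Q0 x (A x) (M x) <= density W Q0 x (A x) N) ->
  12^-1 * L^-1 * (lo / 16) * \int[mu]_(x in D) (k1 x ^+ 2) <= J L W A Q0 M /\
  J L W A Q0 M <= 12^-1 * L^-1 * (up * 2) * \int[mu]_(x in D) (k1 x ^+ 2).
Proof.
move=> LM Mmin; have ik := integrable_smallest_eigenvalue.
have iM := integrable_density LM; have [MT _] := LM.
have L12 : 0 <= 12^-1 * L^-1 by rewrite mulr_ge0// invr_ge0 ltW.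
have iZ c : mu.-integrable D (EFin \o (fun x => c * k1 x ^+ 2)).
  have iZ := @integrableZl _ _ _ mu D mD c _ ik.
  by apply: (@eq_integrable _ _ _ mu D mD _ _ _ iZ).
split; rewrite JE.
  rewrite -[leLHS]mulrA ler_wpM2l// -RintegralZl//; apply: le_Rintegral => // x Dx.
  by apply: (density_ge_eigen hE c0_gt0 Q3_coer (Q0D Dx) (AT Dx) (eA Dx)); exact: MT.
rewrite -[leRHS]mulrA ler_wpM2l// -RintegralZl//; apply: le_Rintegral => // x Dx.
apply: le_trans (Mmin x _ Dx (tr_competitor (k1 x) (AT Dx))) _.
exact: (density_competitor_le hE c0_gt0 Q3_coer (Q0D Dx) (eA Dx)).
Qed.

Lemma minimizer_separation_ae N : is_minimizer L (J L W A Q0) N ->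
  {ae mu, forall x, D x -> lo / (13 * up) * `|k1 x| <= frob (N x - A x)}.
Proof.
move=> Nmin; have [M LM Mmin] := exists_pointwise_minimizer.
have [[NT _] _] := Nmin.
have [Z [mZ Z0 HZ]] := minimizer_ae LM Mmin Nmin.
exists Z; split=> // x nx; apply: HZ => /= H; apply: nx => Dx.
have Hx := minimizer_separation hE c0_gt0 Q3_coer (Q0D Dx) (AT Dx) (eA Dx) (NT _ Dx) (H Dx).
rewrite -ler_sqr ?nnegrE ?frob_ge0//; last first.
  rewrite mulr_ge0// divr_ge0//; first by rewrite divr_ge0// ltW.
  rewrite mulr_ge0//.
  have /andP[l1 l2] := alpha_plus_bounds hE c0_gt0 Q3_coer (Q0D Dx).
  by apply: le_trans (le_trans l1 l2); rewrite divr_ge0// ltW.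
by rewrite sqr_frob exprMn real_normK ?num_real.
Qed.

End Functional.

Theorem proposition5p9 (R : realType) (L : R) (hL : 0 < L)
    (kappa : R -> R) (hkappa : smooth_on 0 L kappa)
    (II0 : R -> 'M[R]_2)
    (hII0_sym : forall x, x \in `[0, L] -> (II0 x)^T = II0 x)
    (hII0 : forall i j, smooth_on 0 L (fun x => II0 x i j))
    (e1 e2 e3 : R -> 'cV[R]_3)
    (hframe : is_frame L kappa II0 e1 e2 e3)
    (hframe0 : SO3 (frame_mx e1 e2 e3 0))
    (W : 'M[R]_3 -> \bar R) (hW : energy_density W)
    (kappa1 kappa2 : R -> R)
    (heig : forall x, x \in `[0, L] ->
      ordered_eigenvalues (II0 x) (kappa1 x) (kappa2 x)) :
  let JJ := J L W II0 (frame_mx e1 e2 e3) in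
  let E := \int[lebesgue_measure]_(x in `]0, L[) (kappa1 x ^+ 2) in
  (exists Mmin : R -> 'M[R]_2,
    [/\ is_minimizer L JJ Mmin,
        exists c C : R, [/\ 0 < c, c < C, c * E <= JJ Mmin & JJ Mmin <= C * E] &
        JJ Mmin = 0 <-> (forall x, x \in `[0, L] -> \det (II0 x) = 0)]) /\
  (exists2 c : R, 0 < c &
    forall Mstar : R -> 'M[R]_2, is_minimizer L JJ Mstar ->
      {ae lebesgue_measure, forall x : R, x \in `]0, L[ ->
        c * `|kappa1 x| <= frob (Mstar x - II0 x)}).

Proof.
move=> JJ E.
have [h hE] := Q3_expansion hW; have [c0 c0_gt0 Q3_coer] := Q3_ge_sym hW.
have L00 := ltW hL.
pose Q0 := frame_mx e1 e2 e3.
have io x : `]0, L[%classic x -> x \in `[0, L].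
  by rewrite /= !in_itv/= => /andP[x0 xL]; rewrite !ltW.
have Q0D x : `]0, L[%classic x -> (Q0 x)^T *m Q0 x = 1%:M.
  by move=> /io; exact: frame_orthogonal hframe hframe0 _.
have cQ0 x i j : `]0, L[%classic x -> {for x, continuous (fun y => Q0 y i j)}.
  by move=> Dx; exact: (frame_entry_continuous hframe).
have cII i j := smooth_on_continuous (hII0 i j).
have cIIo i j x : `]0, L[%classic x -> {for x, continuous (fun y => II0 y i j)}.
  by move=> Dx; exact: (within_continuous_continuous hL (cII i j)).
have mII i j : measurable_fun `]0, L[ (fun x => II0 x i j).
  apply: open_continuous_measurable_fun; first exact: interval_open.
  by move=> x; rewrite inE; exact: cIIo.
have [K K0 AK] : exists2 K, 0 <= K & forall x i j, `]0, L[%classic x -> `|II0 x i j| <= K.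
  have bnd i j := within_continuous_bounded L00 (cII i j).
  pose k i j := projT1 (cid2 (bnd i j)).
  have [k0 kP] : (forall i j, 0 <= k i j) /\
      forall i j x, x \in `[0, L] -> `|II0 x i j| <= k i j.
    by split=> i j; rewrite /k; case: cid2.
  exists (\sum_i \sum_j k i j).
    by apply: sumr_ge0 => i _; apply: sumr_ge0 => j _.
  move=> x i j /io xL; apply: le_trans (kP i j x xL) _.
  rewrite (bigD1 i)//= (bigD1 j)//= -addrA lerDl addr_ge0//.
    by apply: sumr_ge0.
  by apply: sumr_ge0 => ? _; apply: sumr_ge0.
have AT x : `]0, L[%classic x -> (II0 x)^T = II0 x by move=> /io; exact: hII0_sym.
have eA x : `]0, L[%classic x -> ordered_eigenvalues (II0 x) (kappa1 x) (kappa2 x).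
  by move=> /io; exact: heig.
split; last first.
  exists (c0 / 9 / (13 * (2 * Cq h))).
    have D0 : `]0, L[%classic (L / 2) by rewrite /= in_itv/=; apply/andP; split; lra.
    have /andP[l1 l2] := alpha_plus_bounds hE c0_gt0 Q3_coer (Q0D _ D0).
    have lo0 : 0 < c0 / 9 by exact: divr_gt0.
    by rewrite divr_gt0// mulr_gt0//; apply: lt_le_trans lo0 (le_trans l1 l2).
  move=> N Nmin.
  exact: (minimizer_separation_ae hE c0_gt0 Q3_coer hL Q0D cQ0 K0 mII AT AK eA Nmin).
have [M LM Mmin] := exists_pointwise_minimizer hE c0_gt0 Q3_coer hL Q0D cQ0 K0 mII AT AK.
have [lbJ ubJ] := minimum_bounds hE c0_gt0 Q3_coer hL Q0D cQ0 K0 mII AT AK eA LM Mmin.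
have E0 : 0 <= E by apply: Rintegral_ge0 => x _; exact: sqr_ge0.
set c := 12^-1 * L^-1 * (c0 / 9 / 16) in lbJ.
have c_gt0 : 0 < c by rewrite /c !mulr_gt0// invr_gt0.
exists M; split.
- exact: (is_minimizer_pointwise hE c0_gt0 Q3_coer hL Q0D cQ0 K0 mII AK LM Mmin).
- set C := 12^-1 * L^-1 * (2 * Cq h * 2) in ubJ.
  (* The maximum with [c + 1] secures the strict inequality between the constants. *)
  exists c, (Num.max C (c + 1)); split => //.
    by rewrite lt_max ltrDl ltr01 orbT.
  by apply: le_trans ubJ _; rewrite ler_wpM2r// le_max lexx.
split=> [J0|detII]; last first.
  have EE : E = 0.
    suff -> : E = \int[lebesgue_measure]_(x in `]0, L[) 0 by rewrite Rintegral_cst// mul0r.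
    apply: eq_Rintegral => x; rewrite inE => Dx; have := detII x (io x Dx).
    rewrite (eigen_det (eA x Dx)).
    have [_ k12] := eA x Dx; move/eqP; rewrite mulf_eq0 => /orP[/eqP ->|/eqP k20].
      by rewrite expr0n.
    by move: k12; rewrite k20 normr0 normr_le0 => /eqP ->; rewrite expr0n.
  apply/eqP; rewrite eq_le; apply/andP; split.
    by apply: le_trans ubJ _; rewrite [X in _ * X]EE mulr0.
  by apply: le_trans lbJ; rewrite [X in _ * X]EE mulr0.
have EE : E = 0.
  apply/eqP; rewrite eq_le E0 andbT -(pmulr_rle0 _ c_gt0); apply: le_trans lbJ _.
  by rewrite [leLHS]J0.
have cdet : {within `[0, L], continuous (fun x => \det (II0 x))}.
  rewrite (_ : (fun x => _) = fun x => II0 x 0 0 * II0 x 1 1 - II0 x 0 1 * II0 x 1 0).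
    by apply: within_continuousB; exact: within_continuousM.
  by apply/funext => x; exact: det_mx2.
(* A vanishing integral gives a zero determinant only almost everywhere; continuity of the
   determinant extends this to the open interval and to its end points. *)
apply: (within_continuous_eq0 hL cdet).
apply: (@ae_eq0_continuous _ `]0, L[); first exact: interval_open.
  by move=> x Dx; exact: (within_continuous_continuous hL cdet).
have ik := integrable_smallest_eigenvalue K0 mII AT AK eA.
have [] := Rintegral_eq0_ae _ ik _ EE => // [x _|Z [mZ Z0 HZ]]; first exact: sqr_ge0.
exists Z; split=> // x nx; apply: HZ => /= H; apply: nx => Dx.
have /eqP := H Dx; rewrite sqrf_eq0 => /eqP k10.
by rewrite (eigen_det (eA x Dx)) k10 mul0r.
Qed.
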